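(* Let $n$ be a positive integer, let $\alpha_0,\dots,\alpha_{n-1}\in\mathbb{D}$, let $A$ be the ($n$-dimensional) compressed multiplication operator on $\mathcal{P}_{n-1}$ with Verblunsky coefficients $\{\alpha_j\}_{j=0}^{n-1}$, and for $\lambda\in\partial\mathbb{D}$ let $U_\lambda$ be the associated $(n+1)$-dimensional unitary operator. Then for each $\lambda\in\partial\mathbb{D}$, the numerical range $N(U_\lambda)$ is a solid $(n+1)$-gon whose sides are tangent to $N(A)$. The boundary $\partial N(A)$ is a strictly convex analytic curve, and $$N(A)=\bigcap_{\lambda\in\partial\mathbb{D}}N(U_\lambda).$$
   Context: $\mathbb{D}$ is the open unit disk. For a polynomial $P$ regarded as having degree $k$, $P^*(z)=z^k\overline{P(1/\bar z)}$. Given $\alpha_0,\dots,\alpha_{n-1}\in\mathbb{D}$ (Verblunsky coefficients), define monic polynomials by $\Phi_0=1$ and Szegő recursion $\Phi_{j+1}(z)=z\Phi_j(z)-\overline{\alpha_j}\,\Phi_j^*(z)$, $0\le j\le n-1$. Put $\rho_j=\sqrt{1-|\alpha_j|^2}$ and $\varphi_j=\Phi_j/(\rho_0\cdots\rho_{j-1})$. For $\lambda\in\partial\mathbb{D}$ the paraorthogonal polynomial (POPUC) is $\Phi_{n+1}(z;\lambda)=z\Phi_n(z)-\bar\lambda\,\Phi_n^*(z)$; it has $n+1$ distinct zeros, all on $\partial\mathbb{D}$. There is a unique probability measure $d\mu^\lambda$ supported exactly on these zeros for which $\varphi_0,\dots,\varphi_n$ are orthonormal in $L^2(\partial\mathbb{D},d\mu^\lambda)$.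 This $L^2$ space is identified with $\mathcal{P}_n$, the polynomials of degree at most $n$ (the resulting inner product on $\mathcal{P}_n$ does not depend on $\lambda$). $U_\lambda$ is the unitary operator of multiplication by $z$ on $L^2(\partial\mathbb{D},d\mu^\lambda)\cong\mathcal{P}_n$; its eigenvalues are the zeros of $\Phi_{n+1}(z;\lambda)$. The compressed multiplication operator $A$ is the compression $A=PU_\lambda P\restriction\mathcal{P}_{n-1}$, with $P$ the orthogonal projection of $\mathcal{P}_n$ onto $\mathcal{P}_{n-1}$ (the orthogonal complement of $\varphi_n$); it does not depend on $\lambda$. The numerical range of an operator $T$ is $N(T)=\{\langle\psi,T\psi\rangle:\|\psi\|=1\}$. A line segment is tangent to the convex set $N(A)$ if it meets $N(A)$ and $N(A)$ lies on one side of the line containing it. *)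

(* Defs.v *)
From HB Require Import structures.
From mathcomp Require Import all_boot all_order all_algebra.
From mathcomp Require Import all_classical all_reals all_analysis.
From mathcomp Require Import complex.

Set Implicit Arguments.
Unset Strict Implicit.
Unset Printing Implicit Defensive.

Import Order.TTheory GRing.Theory Num.Theory.
Import numFieldNormedType.Exports.

Local Open Scope classical_set_scope.
Local Open Scope ring_scope.
Local Open Scope complex_scope.

Section OrthogonalPolynomials.
Variable R : realType.
Local Notation C := R[i].
Implicit Types (alpha : nat -> C) (lambda : C) (p q : {poly C}) (w : C -> R).

(* P^*(z) = z^k conj(P(1/conj z)), for P regarded as having degree k. *)
Definition revpoly (k : nat) p : {poly C} := \poly_(i < k.+1) (p`_(k - i))^*.

Fixpoint Phi alpha (k : nat) : {poly C} :=
  if k is j.+1 then 'X * Phi alpha j - (alpha j)^* *: revpoly j (Phi alpha j)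
  else 1.

(* rho_j and the norming constants are taken in R[i]; they are real and
   positive as soon as |alpha_j| < 1. *)
Definition rho alpha (j : nat) : C := sqrtC (1 - `|alpha j| ^+ 2).

Definition phi alpha (k : nat) : {poly C} :=
  (\prod_(j < k) rho alpha j)^-1 *: Phi alpha k.

(* Phi_{n+1}(z; lambda). *)
Definition popuc alpha (n : nat) lambda : {poly C} :=
  'X * Phi alpha n - lambda^* *: revpoly n (Phi alpha n).

(* A finitely supported measure on R[i] is given by its point masses w;
   this is the integral of conj(p) q against it, the sum being over the
   (finite) support. *)
Definition L2_inner w p q : C :=
  \sum_(z \in [set: C]) ((w z)%:C * (p.[z])^* * q.[z]).

Definition is_popuc_measure alpha (n : nat) lambda w :=
  [/\ forall z, root (popuc alpha n lambda) z -> 0 < w z,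
      forall z, ~~ root (popuc alpha n lambda) z -> w z = 0,
      \sum_(z \in [set: C]) w z = 1 &
      forall j k, (j <= n)%N -> (k <= n)%N ->
        L2_inner w (phi alpha j) (phi alpha k) = (j == k)%:R].

(* The unique w such that is_popuc_measure alpha n lambda w. *)
Definition popuc_measure alpha (n : nat) lambda : C -> R :=
  xget (fun=> 0) [set w | is_popuc_measure alpha n lambda w].

(* polys d is the space of polynomials of degree < d, so P_n is polys n.+1. *)
Definition polys (d : nat) : set {poly C} := [set p | (size p <= d)%N].

Definition inner alpha (n : nat) lambda p q : C :=
  L2_inner (popuc_measure alpha n lambda) p q.

(* Multiplication by z on L^2(dmu^lambda), transported to P_n: the polynomial
   of degree at most n that agrees with z p(z) at the n+1 zeros of the POPUC;
   see mulz_size and mulz_horner. *)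
Definition mulz alpha (n : nat) lambda p : {poly C} :=
  (('X * p) %% popuc alpha n lambda)%R.

(* Orthogonal projection of P_n onto the orthogonal complement of phi_n. *)
Definition proj alpha (n : nat) lambda p : {poly C} :=
  p - inner alpha n lambda (phi alpha n) p *: phi alpha n.

(* The compression P U_lambda P. *)
Definition compressed alpha (n : nat) lambda p : {poly C} :=
  proj alpha n lambda (mulz alpha n lambda (proj alpha n lambda p)).

Definition numerical_range (ip : {poly C} -> {poly C} -> C)
    (V : set {poly C}) (T : {poly C} -> {poly C}) : set C :=
  [set ip psi (T psi) | psi in [set psi | V psi /\ ip psi psi = 1]].

Definition NU alpha (n : nat) lambda : set C :=
  numerical_range (inner alpha n lambda) (polys n.+1) (mulz alpha n lambda).

(* lambda is only the parameter through which A is computed. *)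
Definition NA alpha (n : nat) lambda : set C :=
  numerical_range (inner alpha n lambda) (polys n) (compressed alpha n lambda).

Lemma size_revpoly k p : (size (revpoly k p) <= k.+1)%N.
Proof. exact: size_poly. Qed.

Lemma size_Phi alpha k : size (Phi alpha k) = k.+1.
Proof.
elim: k => [|k IHk] /=; first by rewrite size_poly1.
have Phi0 : Phi alpha k != 0 by rewrite -size_poly_gt0 IHk.
rewrite size_polyDl mulrC size_mulX// ?IHk// size_polyN.
by rewrite (leq_ltn_trans (size_scale_leq _ _))// ltnS size_revpoly.
Qed.

Lemma size_popuc alpha n lambda : size (popuc alpha n lambda) = n.+2.
Proof.
have Phi0 : Phi alpha n != 0 by rewrite -size_poly_gt0 size_Phi.
rewrite /popuc size_polyDl mulrC size_mulX// ?size_Phi// size_polyN.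
by rewrite (leq_ltn_trans (size_scale_leq _ _))// ltnS size_revpoly.
Qed.

Lemma mulz_size alpha n lambda p : polys n.+1 (mulz alpha n lambda p).
Proof.
rewrite /polys /= -ltnS -(size_popuc alpha n lambda) ltn_modp.
by rewrite -size_poly_gt0 size_popuc.
Qed.

Lemma mulz_horner alpha n lambda p z :
  root (popuc alpha n lambda) z -> (mulz alpha n lambda p).[z] = z * p.[z].
Proof.
move=> /rootP Pz; have /(congr1 (horner^~ z)) :=
  divp_eq ('X * p) (popuc alpha n lambda).
by rewrite hornerM hornerX hornerD hornerM Pz mulr0 add0r => ->.
Qed.

End OrthogonalPolynomials.

Section PlaneConvexity.
Variable R : realType.
Local Notation C := R[i].
Implicit Types (K S : set C) (a b : C).

Definition segment a b : set C :=
  [set (1 - t)%:C * a + t%:C * b | t in `[0, 1]].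

Definition hull (m : nat) (v : 'I_m -> C) : set C :=
  [set \sum_(i < m) (t i)%:C * v i |
    t in [set t : 'I_m -> R | (forall i, 0 <= t i) /\ \sum_(i < m) t i = 1]].

Definition extreme_point K (x : C) :=
  K x /\ forall a b (t : R), K a -> K b -> 0 < t < 1 ->
    x = (1 - t)%:C * a + t%:C * b -> a = b.

(* The convex hull of m points, all of which are vertices; for m = 2 this is
   a nondegenerate segment. *)
Definition solid_polygon (m : nat) K :=
  exists v : 'I_m -> C,
    [/\ injective v, K = hull v & forall i, extreme_point K (v i)].

(* Re (u^* z) is the real scalar product of u and z in the plane, so
   Re (u^* z) = c is a line. The segment from a to b is a side of K when some
   supporting line of K meets K exactly in it. For K a nondegenerate segment
   (a 2-gon), K is its own side. *)
Definition side K a b :=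
  a <> b /\ exists (u : C) (c : R),
    [/\ u <> 0, forall z, K z -> complex.Re (u^* * z) <= c &
        K `&` [set z | complex.Re (u^* * z) = c] = segment a b].

(* Im ((b - a)^* (z - a)) is the signed distance, up to the factor |b - a|,
   from z to the line through a and b. *)
Definition tangent_segment a b K :=
  (segment a b `&` K !=set0) /\
  ((forall z, K z -> 0 <= complex.Im ((b - a)^* * (z - a))) \/
   (forall z, K z -> complex.Im ((b - a)^* * (z - a)) <= 0)).

(* R[i]^o carries the topology of the norm of R[i]. *)
Definition boundary S : set C := (closure (S : set C^o)) `\` interior (S : set C^o).

(* A supporting line passes through every point of S, and S contains no
   nondegenerate line segment. *)
Definition strictly_convex_curve S :=
  (forall p, S p -> exists u : C,
     u <> 0 /\ forall z, S z -> complex.Re (u^* * (z - p)) <= 0) /\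
  (forall a b, segment a b `<=` S -> a = b).

Definition real_analytic (f : R -> R) :=
  forall t0 : R, exists (r : R) (c : nat -> R),
    0 < r /\ forall t, `|t - t0| < r -> pseries c (t - t0) @ \oo --> f t.

(* S is the image of a simple closed real-analytic curve with nowhere
   vanishing velocity. *)
Definition analytic_closed_curve S :=
  exists x y : R -> R,
    [/\ real_analytic x /\ real_analytic y,
        (forall t, x (t + 2 * pi) = x t) /\ (forall t, y (t + 2 * pi) = y t),
        (forall s t, s \in `[0, 2 * pi[ -> t \in `[0, 2 * pi[ ->
           x s = x t -> y s = y t -> s = t),
        (forall t, derive1 x t != 0 \/ derive1 y t != 0) &
        S = range (fun t => x t +i* y t)].

End PlaneConvexity.

(* Main.v *)
(* On the circle z Phi_n(z) / Phi_n^*(z) is e^{i eta} with eta strictly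
   increasing, so, tau being the inverse of eta / (n + 1), the zeros of the POPUC
   are the points z_k = e^{i tau(t + 2 pi k / (n + 1))}, where t encodes lambda.
   The Christoffel-Darboux formula yields the measures, and Lagrange interpolation
   at the zeros turns N(U_lambda) into the convex hull of the z_k and N(A) into
   { sum G_k |d_k|^2 z_k : sum d_k = 0, sum G_k |d_k|^2 = 1 } for some positive
   weights G_k.  Using only two nonzero coordinates, N(A) touches each chord
   [z_j, z_k].

   Let I be the intersection of the half-planes bounded by the lines through z_0
   and z_1, over all t.  A point of I on the line of parameter t is a minimum of
   its distance to the lines as a function of t; differentiating in t determines
   it, so it is the contact point of N(A), given by an explicit formula p(t) in
   tau and tau'.  Hence p parametrizes the boundary of I, and as N(A) is convex
   (Toeplitz-Hausdorff) and contains p, it equals I.  The curve p is analytic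
   because its coordinates belong to a polynomial differential system, and three
   nonzero coordinates d_k give enough points of N(A) near p(t) to exclude
   corners, hence to prove that the velocity of p does not vanish and that p is
   injective. *)

Require Import Defs.
From mathcomp Require Import all_boot all_order all_algebra.
From mathcomp Require Import all_classical all_reals all_analysis.
From mathcomp Require Import complex ring lra.

Import Order.TTheory GRing.Theory Num.Theory.
Import numFieldNormedType.Exports.

Local Open Scope classical_set_scope.
Local Open Scope ring_scope.
Local Open Scope complex_scope.

Set Implicit Arguments.
Unset Strict Implicit.
Unset Printing Implicit Defensive.

(** * Analyticity of solutions of polynomial differential equations *)

Section PointwiseDerivatives.
Variables (R : realType).
Implicit Types (f g : R -> R) (t a b : R).

(** Two obstacles shape the argument. First, [tau] inverts a phase known only through a recursion.
    Its analyticity is obtained without inverting power series: [tau] solves an autonomous equation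
    whose field [v] is rational in cosines and sines, so everything built on it stays within
    polynomial systems, where the growth of derivatives can be counted. Second, an envelope may stop
    moving: at a corner of N(A) many lines would share one contact point, and contact alone cannot
    exclude this. Two nodes only see the contact; a third node yields a quadratic inequality in a
    free parameter, whose discriminant bounds from below the gap between a contact point and the
    nearby lines. That node requires n > 1; for n = 1 the range is a point. Throughout, the weights
    G depend on the line while N(A) does not, because the orthonormal [phi j] fix the inner product;
    each line is studied in its own coordinates. *)

Lemma is_derive_constf (c t : R) : is_derive t 1 (fun=> c) 0.
Proof. exact: is_derive_cst. Qed.

Lemma is_derive_addf f g t a b : is_derive t 1 f a -> is_derive t 1 g b ->
  is_derive t 1 (fun s => f s + g s) (a + b).
Proof. by move=> fa gb; exact: is_deriveD. Qed.

Lemma is_derive_subf f g t a b : is_derive t 1 f a -> is_derive t 1 g b ->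
  is_derive t 1 (fun s => f s - g s) (a - b).
Proof. by move=> fa gb; exact: is_deriveB. Qed.

Lemma is_derive_mulf f g t a b : is_derive t 1 f a -> is_derive t 1 g b ->
  is_derive t 1 (fun s => f s * g s) (a * g t + f t * b).
Proof.
move=> fa gb; have h := is_deriveM fa gb; apply: (is_derive_eq h).
by rewrite /GRing.scale/= addrC mulrC.
Qed.

Lemma is_derive_compf f g t a b : is_derive t 1 f a -> is_derive (f t) 1 g b ->
  is_derive t 1 (fun s => g (f s)) (a * b).
Proof.
move=> fa gb; have h := is_derive1_comp gb fa; apply: (is_derive_eq h).
by rewrite /GRing.scale/= mulrC.
Qed.

Lemma is_derive_invf f t a : f t != 0 -> is_derive t 1 f a ->
  is_derive t 1 (fun s => (f s)^-1) (- a / f t ^+ 2).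
Proof.
move=> ft0 fa; have h := is_deriveV ft0 fa; apply: (is_derive_eq h).
by rewrite /GRing.scale/= mulNr mulrC mulNr.
Qed.

Lemma is_derive_expf f t a n : is_derive t 1 f a ->
  is_derive t 1 (fun s => f s ^+ n) (n%:R * f t ^+ n.-1 * a).
Proof.
move=> fa; have h := is_deriveX n fa.
rewrite (_ : (fun s => f s ^+ n) = f ^+ n); first exact: (is_derive_eq h).
by apply/funext => s; rewrite exprfctE.
Qed.

End PointwiseDerivatives.

Lemma is_derive_cont (R : realType) (f : R -> R) (t d : R) :
  is_derive t 1 f d -> {for t, continuous f}.
Proof.
by move=> df; apply/differentiable_continuous/derivable1_diffP; exact: ex_derive.
Qed.

Lemma mean_value (R : realType) (f df : R -> R) (a b : R) :
  (forall x : R, is_derive x 1 f (df x)) ->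
  exists c, [/\ `|c - a| <= `|b - a|, `|b - c| <= `|b - a| &
               f b - f a = df c * (b - a)].
Proof.
move=> fdf; have cf x : {for x, continuous f} by exact: is_derive_cont.
have cw (A : set R) : {within A, continuous f} by exact: continuous_subspaceT.
case: (leP a b) => ab.
  have [c /[!in_itv]/= /andP[ac cb] e] := MVT_segment ab (fun x _ => fdf x) (cw _).
  by exists c; split => //; rewrite !ger0_norm; lra.
have [c /[!in_itv]/= /andP[ac cb] e] :=
  MVT_segment (ltW ab) (fun x _ => fdf x) (cw _).
by exists c; split; [rewrite !ler0_norm; lra|rewrite !ler0_norm; lra|lra].
Qed.

(** * Polynomial vector fields and the growth of iterated derivations *)

Section PolynomialExpressions.
Variables (R : realType).

(** Polynomials are kept as syntax: derivation, degree bound and norm are structural recursions, and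
    cancellations may be ignored since only upper bounds are wanted. *)
Inductive expr (I : Type) : Type :=
  | Cst of R
  | Var of I
  | Add of expr I & expr I
  | Mul of expr I & expr I.

Arguments Cst {I}.

Fixpoint ev (I : Type) (y : I -> R) (e : expr I) : R :=
  match e with
  | Cst c => c
  | Var i => y i
  | Add a b => ev y a + ev y b
  | Mul a b => ev y a * ev y b
  end.

Fixpoint subst (I J : Type) (f : I -> expr J) (e : expr I) : expr J :=
  match e with
  | Cst c => Cst c
  | Var i => f i
  | Add a b => Add (subst f a) (subst f b)
  | Mul a b => Mul (subst f a) (subst f b)
  end.

Lemma ev_subst (I J : Type) (f : I -> expr J) (y : J -> R) (e : expr I) :
  ev y (subst f e) = ev (fun i => ev y (f i)) e.
Proof. by elim: e => //= a -> b ->. Qed.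

(* The derivation of the polynomial ring attached to the vector field P. *)
Fixpoint dexpr (I : Type) (P : I -> expr I) (e : expr I) : expr I :=
  match e with
  | Cst c => Cst 0
  | Var i => P i
  | Add a b => Add (dexpr P a) (dexpr P b)
  | Mul a b => Add (Mul (dexpr P a) b) (Mul a (dexpr P b))
  end.

Fixpoint edeg (I : Type) (e : expr I) : nat :=
  match e with
  | Cst c => 0
  | Var i => 1
  | Add a b => maxn (edeg a) (edeg b)
  | Mul a b => edeg a + edeg b
  end.

Fixpoint enorm (I : Type) (M : R) (e : expr I) : R :=
  match e with
  | Cst c => `|c|
  | Var i => M
  | Add a b => enorm M a + enorm M b
  | Mul a b => enorm M a * enorm M b
  end.

Lemma enorm_ge0 (I : Type) (M : R) (e : expr I) : 0 <= M -> 0 <= enorm M e.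
Proof.
move=> M0; elim: e => //= a IHa b IHb; first exact: addr_ge0.
exact: mulr_ge0.
Qed.

Lemma ev_le_enorm (I : Type) (M : R) (y : I -> R) (e : expr I) : 0 <= M ->
  (forall i, `|y i| <= M) -> `|ev y e| <= enorm M e.
Proof.
move=> M0 yM; elim: e => //= a IHa b IHb.
  by rewrite (le_trans (ler_normD _ _))// lerD.
by rewrite normrM ler_pM.
Qed.

Lemma edeg_dexpr (I : Type) (P : I -> expr I) (p : nat) (e : expr I) :
  (forall i, (edeg (P i) <= p.+1)%N) -> (edeg (dexpr P e) <= edeg e + p)%N.
Proof.
move=> degP; elim: e => [//|i|a IHa b IHb|a IHa b IHb] /=.
- by rewrite add1n.
- rewrite geq_max addn_maxl; apply/andP; split.
    by rewrite (leq_trans IHa)// leq_maxl.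
  by rewrite (leq_trans IHb)// leq_maxr.
- rewrite geq_max; apply/andP; split; first by rewrite addnAC leq_add2r.
  by rewrite -addnA leq_add2l.
Qed.

(** By Leibniz, each of the at most [edeg e] variables of a monomial is replaced in turn by some
    [P i], at the cost of a factor [N]. *)
Lemma enorm_dexpr (I : Type) (P : I -> expr I) (M N : R) (e : expr I) :
  0 <= M -> 0 <= N -> (forall i, enorm M (P i) <= N * M) ->
  enorm M (dexpr P e) <= (edeg e)%:R * N * enorm M e.
Proof.
move=> M0 N0 nP; elim: e => /= [c|i|a IHa b IHb|a IHa b IHb].
- by rewrite normr0 !mul0r.
- by rewrite mul1r.
- rewrite mulrDr lerD//.
    rewrite (le_trans IHa)// ler_wpM2r ?enorm_ge0// ler_wpM2r// ler_nat.
    exact: leq_maxl.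
  rewrite (le_trans IHb)// ler_wpM2r ?enorm_ge0// ler_wpM2r// ler_nat.
  exact: leq_maxr.
- have a0 := enorm_ge0 a M0; have b0 := enorm_ge0 b M0.
  have := ler_wpM2r b0 IHa; have := ler_wpM2l a0 IHb.
  rewrite natrD; move=> h1 h2.
  rewrite (le_trans (lerD h2 h1))// le_eqVlt; apply/orP; left; apply/eqP; ring.
Qed.

(** After j derivations the degree is at most [edeg e + j * p], hence at most j + 1 times
    [edeg e + p]; the factors j + 1 multiply to k!, which the Taylor coefficients divide out. *)
Lemma enorm_iter_dexpr (I : Type) (P : I -> expr I) (M N : R) (p : nat)
    (e : expr I) k :
  0 <= M -> 0 <= N -> (forall i, enorm M (P i) <= N * M) ->
  (forall i, (edeg (P i) <= p.+1)%N) ->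
  enorm M (iter k (dexpr P) e) <=
    (N * (edeg e + p)%:R) ^+ k * k`!%:R * enorm M e.
Proof.
move=> M0 N0 nP dP; have degk j : (edeg (iter j (dexpr P) e) <= edeg e + j * p)%N.
  elim: j => [|j IHj]; first by rewrite mul0n addn0.
  rewrite iterS (leq_trans (edeg_dexpr _ dP))// mulSn addnCA addnC leq_add2l.
  exact: IHj.
elim: k => [|k IHk]; first by rewrite expr0 fact0 !mul1r.
rewrite iterS (le_trans (enorm_dexpr _ M0 N0 nP))//.
rewrite (@le_trans _ _ ((k.+1 * (edeg e + p))%:R * N *
  ((N * (edeg e + p)%:R) ^+ k * k`!%:R * enorm M e)))//.
  rewrite ler_pM ?mulr_ge0 ?enorm_ge0//.
  rewrite ler_wpM2r// ler_nat (leq_trans (degk k))// mulnDr leq_add//.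
    exact: leq_pmull.
  by rewrite leq_mul2r leqnSn orbT.
rewrite le_eqVlt; apply/orP; left; apply/eqP.
by rewrite exprS factS !natrM; ring.
Qed.

Lemma is_derive_ev (I : Type) (P : I -> expr I) (y : I -> R -> R) (e : expr I) (t : R) :
  (forall i, is_derive t 1 (y i) (ev (y^~ t) (P i))) ->
  is_derive t 1 (fun s => ev (y^~ s) e) (ev (y^~ t) (dexpr P e)).
Proof.
move=> dy; elim: e => [c|i|a IHa b IHb|a IHa b IHb] /=.
- exact: is_derive_cst.
- exact: dy.
- exact: is_deriveD.
- exact: is_derive_mulf.
Qed.

(* Each solution of a polynomial system y' = P(y) is analytic: the k-th
   derivative is D^k applied to a coordinate, where D is the derivation attached
   to P, and D multiplies the norm of a polynomial of degree d by O(d) while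
   raising the degree by O(1), so that k-th derivatives are O(K^k k!). *)
Lemma real_analytic_ode (I : finType) (P : I -> expr I) (y : I -> R -> R)
    (e : expr I) :
  (forall i (t : R), is_derive t 1 (y i) (ev (y^~ t) (P i))) ->
  real_analytic (fun t => ev (y^~ t) e).
Proof.
move=> dy t0.
have /choice[B yB] i : exists b : R, forall t : R, `|t - t0| <= 1 -> `|y i t| <= b.
  have cy : {within `[t0 - 1, t0 + 1], continuous (fun t => `|y i t|)}.
    apply: continuous_subspaceT => t; apply: continuous_comp.
      exact: is_derive_cont (dy i t).
    exact: norm_continuous.
  have [|c _ maxc] := EVT_max _ cy; first by lra.
  exists (`|y i c|) => t; rewrite ler_norml => /andP[h1 h2]; apply: maxc.
  by rewrite in_itv/=; apply/andP; split; lra.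
pose M : R := 1 + \sum_i `|B i|.
have M1 : 1 <= M by rewrite lerDl sumr_ge0.
have M0 : 0 <= M by exact: le_trans M1.
have yM i t : `|t - t0| <= 1 -> `|y i t| <= M.
  move=> /(yB i)/le_trans; apply; rewrite (le_trans (ler_norm _))//.
  by rewrite /M (bigD1 i)//= addrCA lerDl addr_ge0// sumr_ge0.
pose N : R := 1 + \sum_i enorm M (P i).
have N1 : 1 <= N by rewrite lerDl sumr_ge0// => i _; exact: enorm_ge0.
have N0 : 0 <= N by exact: le_trans N1.
have nP i : enorm M (P i) <= N * M.
  apply: (@le_trans _ _ (N * 1)); last by rewrite ler_wpM2l.
  rewrite mulr1 /N (bigD1 i)//= addrCA lerDl addr_ge0// sumr_ge0// => j _.
  exact: enorm_ge0.
pose p := \max_i edeg (P i).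
have dP i : (edeg (P i) <= p.+1)%N.
  by apply: leq_trans (leqnSn _); exact: (leq_bigmax (F := fun i => edeg (P i))).
pose K := N * (edeg e + p)%:R.
have K0 : 0 <= K by rewrite mulr_ge0.
pose C := enorm M e.
have C0 : 0 <= C by exact: enorm_ge0.
pose f k := fun t : R => ev (y^~ t) (iter k (dexpr P) e).
have df k (t : R) : is_derive t 1 (f k) (f k.+1 t) by exact: is_derive_ev.
have fK k t : `|t - t0| <= 1 -> `|f k t| <= K ^+ k * k`!%:R * C.
  move=> tt0; apply: le_trans (enorm_iter_dexpr e k M0 N0 nP dP).
  by apply: ev_le_enorm => // i; exact: yM.
(* The radius makes [K] times |x| at most 1/4. The factor n + 1 left by the factorials in the
   remainder is below 2^(n+1), so that a ratio 1/2 survives. *)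
exists (4 * (1 + K))^-1, (fun k => f k t0 / k`!%:R); split.
  by rewrite invr_gt0; lra.
move=> t; set x := t - t0 => xr.
have Kx : K * `|x| <= 4^-1.
  have h : (4 * (1 + K))^-1 * (4 * (1 + K)) = 1 by rewrite mulVf//; lra.
  have h2 : `|x| * (4 * (1 + K)) <= 1 by rewrite -[leRHS]h ler_wpM2r ?ltW//; lra.
  have := normr_ge0 x; nra.
have x1 : `|x| <= 1.
  by apply: le_trans (ltW xr) _; rewrite invf_le1; lra.
(* The Taylor polynomial at the moving centre [s], evaluated at [t]: its derivative in [s]
   telescopes to one term, and the mean value theorem gives Cauchy's form of the remainder. *)
pose F n (s : R) : R := \sum_(k < n) f k s / k`!%:R * (t - s) ^+ k.
have F1 (s : R) : is_derive s 1 (F 1%N) (f 1%N s).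
  rewrite (_ : F 1%N = f 0%N) ?{1}/F; first exact: df.
  apply/funext => u; rewrite /F big_ord_recl big_ord0 /= expr0 fact0.
  by rewrite divr1 mulr1 addr0.
have dF n (s : R) : is_derive s 1 (F n.+1) (f n.+1 s / n`!%:R * (t - s) ^+ n).
  elim: n => [|n IHn].
    by rewrite fact0 divr1 expr0 mulr1; exact: F1.
  rewrite (_ : F n.+2 = F n.+1 + (fun s => f n.+1 s / n.+1`!%:R * (t - s) ^+ n.+1));
    last by apply/funext => u; rewrite /F big_ord_recr.
  have dfn := df n.+1 s.
  have dX : is_derive s 1 (fun u => (t - u) ^+ n.+1)
                    (- (n.+1%:R * (t - s) ^+ n)).
    have dB := is_derive_subf (is_derive_cst t s 1) (is_derive_id s 1).
    by apply: (is_derive_eq (is_derive_expf n.+1 dB)); rewrite sub0r mulrN1.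
  have dC : is_derive s 1 (fun u => f n.+1 u / n.+1`!%:R)
                    (f n.+2 s / n.+1`!%:R).
    apply: (is_derive_eq (is_derive_mulf dfn (is_derive_cst _ _ _))).
    by rewrite mulr0 addr0.
  apply: (is_derive_eq (is_derive_addf IHn (is_derive_mulf dC dX))).
  have n1 : n.+1%:R != 0 :> R by rewrite pnatr_eq0.
  have nf : n`!%:R != 0 :> R by rewrite pnatr_eq0 -lt0n fact_gt0.
  rewrite factS natrM; field.
  by rewrite nf nat1r n1.
have Ft n : F n.+1 t = f 0%N t.
  rewrite /F big_ord_recl /= subrr expr0 fact0 divr1 mulr1 big1 ?addr0// => i _.
  by rewrite expr0n mulr0.
have err n : `|f 0%N t - F n.+1 t0| <= C * (1 / 2) ^+ n.
  rewrite -(Ft n); have [c [ct0 tc ->]] := mean_value t0 t (dF n).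
  rewrite !normrM normfV normrX -/x.
  have h1 := fK n.+1 c (le_trans ct0 x1).
  have nf : 0 < n`!%:R :> R by rewrite ltr0n fact_gt0.
  have h2 : `|f n.+1 c| / `|n`!%:R| <= K ^+ n.+1 * n.+1%:R * C.
    rewrite [`|n`!%:R|]ger0_norm ?ler0n// ler_pdivrMr//; apply: le_trans h1 _.
    rewrite le_eqVlt; apply/orP; left; apply/eqP.
    by rewrite factS natrM; ring.
  have h3 : `|t - c| ^+ n <= `|x| ^+ n by rewrite lerXn2r// ?nnegrE.
  have h4 : `|f n.+1 c| / `|n`!%:R| * `|t - c| ^+ n * `|x| <=
      (K ^+ n.+1 * n.+1%:R * C) * `|x| ^+ n * `|x|.
    by apply: ler_wpM2r => //; apply: ler_pM => //.
  apply: le_trans h4 _.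
  have -> : (K ^+ n.+1 * n.+1%:R * C) * `|x| ^+ n * `|x| =
            C * ((K * `|x|) ^+ n.+1 * n.+1%:R).
    by rewrite [(K * _) ^+ _]exprMn !exprS; ring.
  rewrite ler_wpM2l//.
  have h5 : (K * `|x|) ^+ n.+1 <= (4^-1) ^+ n.+1.
    by rewrite lerXn2r// ?nnegrE ?mulr_ge0.
  have h6 : n.+1%:R <= 2 ^+ n.+1 :> R.
    by rewrite -natrX ler_nat ltnW// ltn_expl.
  apply: (@le_trans _ _ ((4^-1) ^+ n.+1 * 2 ^+ n.+1)).
    by rewrite ler_pM ?exprn_ge0 ?mulr_ge0.
  rewrite -exprMn (_ : 4^-1 * 2 = 1 / 2); last by field.
  by rewrite exprS ler_piMl ?exprn_ge0//; lra.
have Fser n : F n t0 = pseries (fun k => f k t0 / k`!%:R) x n.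
  by rewrite /F /pseries /series/= big_mkord.
rewrite -(cvg_shiftS (pseries _ _)).
apply/cvgrPdist_le => eps eps0.
have : (fun n => C * (1 / 2) ^+ n) @ \oo --> (0 : R).
  by apply: cvg_geometric; rewrite ger0_norm; lra.
move=> /cvgrPdist_le/(_ _ eps0); apply: filterS => n.
rewrite sub0r normrN => h; rewrite /= -Fser.
apply: le_trans (err n) (le_trans (ler_norm _) h).
Qed.

(** A class inside the analytic functions that is closed under arithmetic, differentiation,
    translation and composition with flows, and so contains [v] and the boundary curve. *)
Definition ode_function (f : R -> R) :=
  exists (I : finType) (y : I -> R -> R) (P : I -> expr I) (e : expr I),
    (forall i (t : R), is_derive t 1 (y i) (ev (y^~ t) (P i))) /\
    f = fun t => ev (y^~ t) e.

Lemma ode_function_analytic f : ode_function f -> real_analytic f.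
Proof. by move=> [I [y [P [e [dy ->]]]]]; exact: real_analytic_ode. Qed.

Lemma ode_function_derive f : ode_function f ->
  exists g, ode_function g /\ forall t : R, is_derive t 1 f (g t).
Proof.
move=> [I [y [P [e [dy ->]]]]]; exists (fun t => ev (y^~ t) (dexpr P e)).
by split=> [|t]; [exists I, y, P, (dexpr P e)|exact: is_derive_ev].
Qed.

Lemma ode_function_join f g : ode_function f -> ode_function g ->
  exists (I : finType) (y : I -> R -> R) (P : I -> expr I) (e1 e2 : expr I),
    [/\ (forall i (t : R), is_derive t 1 (y i) (ev (y^~ t) (P i))),
        f = fun t => ev (y^~ t) e1 & g = fun t => ev (y^~ t) e2].
Proof.
move=> [I [y [P [e [dy ->]]]]] [J [z [Q [d [dz ->]]]]].
pose w (k : I + J) := match k with inl i => y i | inr j => z j end.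
pose inI (i : I) : expr (I + J)%type := Var (inl i).
pose inJ (j : J) : expr (I + J)%type := Var (inr j).
exists (I + J)%type, w,
  (fun k => match k with inl i => subst inI (P i) | inr j => subst inJ (Q j) end),
  (subst inI e), (subst inJ d); split.
- by move=> [i|j] t; rewrite ev_subst; [exact: dy|exact: dz].
- by apply/funext => t; rewrite ev_subst.
- by apply/funext => t; rewrite ev_subst.
Qed.

Lemma ode_function_cst (c : R) : ode_function (fun=> c).
Proof. by exists void, (fun _ _ => 0), (fun _ => Cst 0), (Cst c); split => [[]|]. Qed.

Lemma ode_function_add f g : ode_function f -> ode_function g ->
  ode_function (fun t => f t + g t).
Proof.
move=> hf hg; have [I [y [P [e1 [e2 [dy -> ->]]]]]] := ode_function_join hf hg.
by exists I, y, P, (Add e1 e2); split.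
Qed.

Lemma ode_function_mul f g : ode_function f -> ode_function g ->
  ode_function (fun t => f t * g t).
Proof.
move=> hf hg; have [I [y [P [e1 [e2 [dy -> ->]]]]]] := ode_function_join hf hg.
by exists I, y, P, (Mul e1 e2); split.
Qed.

Lemma ode_function_opp f : ode_function f -> ode_function (fun t => - f t).
Proof.
move=> hf; have := ode_function_mul (ode_function_cst (-1)) hf.
by under eq_fun do rewrite mulN1r.
Qed.

Lemma ode_function_sub f g : ode_function f -> ode_function g ->
  ode_function (fun t => f t - g t).
Proof. by move=> hf hg; apply: ode_function_add => //; exact: ode_function_opp. Qed.

(** The reciprocal u of f joins the system as a new variable, with derivative - f' u^2. *)
Lemma ode_function_inv f : (forall t, f t != 0) -> ode_function f ->
  ode_function (fun t => (f t)^-1).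
Proof.
move=> f0 [I [y [P [e [dy fe]]]]].
pose w (k : option I) := if k is Some i then y i else fun t => (f t)^-1.
pose inI (i : I) : expr (option I) := Var (Some i).
pose Q (k : option I) := if k is Some i then subst inI (P i) else
  Mul (Cst (-1)) (Mul (subst inI (dexpr P e)) (Mul (Var None) (Var None))).
exists (option I), w, Q, (Var None); split=> //.
case=> [i|] t; rewrite /= ?ev_subst//.
have df : is_derive t 1 f (ev (y^~ t) (dexpr P e)) by rewrite fe; exact: is_derive_ev.
apply: (is_derive_eq (is_derive_invf (f0 t) df)).
by rewrite fe /=; field; rewrite -[X in X != 0]/((fun t => ev (y^~ t) e) t) -fe.
Qed.

Lemma ode_function_cos_sin : ode_function cos /\ ode_function sin.
Proof.
pose y (b : bool) := if b then @cos R else sin.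
pose P (b : bool) : expr bool := if b then Mul (Cst (-1)) (Var false) else Var true.
have dy b (t : R) : is_derive t 1 (y b) (ev (y^~ t) (P b)).
  case: b; rewrite /= ?mulN1r; first exact: is_derive_cos.
  exact: is_derive_sin.
by split; [exists bool, y, P, (Var true)|exists bool, y, P, (Var false)].
Qed.

Lemma ode_function_shift f b : ode_function f -> ode_function (fun t => f (t + b)).
Proof.
move=> [I [y [P [e [dy ->]]]]].
exists I, (fun i t => y i (t + b)), P, e; split=> // i t.
have dt := is_derive_addf (is_derive_id t (1 : R)) (is_derive_cst b t 1).
by apply: (is_derive_eq (is_derive_compf dt (dy i (t + b)))); rewrite addr0 mul1r.
Qed.

(** Composition with [tau] multiplies the vector field by [v], itself a polynomial in the joint
    variables. This is how the inverse of the phase enters the class. *)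
Lemma ode_function_flow v tau f : ode_function v ->
  (forall t : R, is_derive t 1 tau (v (tau t))) ->
  ode_function f -> ode_function (fun t => f (tau t)).
Proof.
move=> hv dtau hf; have [I [y [P [e1 [e2 [dy ve fe]]]]]] := ode_function_join hv hf.
exists I, (fun i t => y i (tau t)), (fun i => Mul e1 (P i)), e2.
split; last by rewrite fe.
move=> i t; apply: (is_derive_eq (is_derive_compf (dtau t) (dy i (tau t)))).
by rewrite ve.
Qed.

End PolynomialExpressions.

(** * The phase of the paraorthogonal polynomials *)

Section UnitCircle.
Variable R : realType.
Local Notation C := R[i].
Implicit Types (s t a b : R) (z w : C).

Definition cis t : C := cos t +i* sin t.

Lemma cisD s t : cis (s + t) = cis s * cis t.
Proof.
rewrite /cis cosD sinD; apply/eqP; rewrite eq_complex /=.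
by apply/andP; split; apply/eqP; ring.
Qed.

Lemma cisN t : cis (- t) = conjc (cis t).
Proof. by rewrite /cis cosN sinN. Qed.

Lemma cis0 : cis 0 = 1.
Proof. by rewrite /cis cos0 sin0. Qed.

Lemma mul_cis_conj t : cis t * conjc (cis t) = 1.
Proof. by rewrite -cisN -cisD subrr cis0. Qed.

Lemma norm_cis t : `|cis t| = 1.
Proof. by apply/eqP; rewrite -(@eqrXn2 _ 2)// sqr_normc mul_cis_conj expr1n. Qed.

Lemma cisD2pi t : cis (t + 2 * pi) = cis t.
Proof. by rewrite /cis mulr2n mulrDl mul1r -mulr2n cosD2pi sinD2pi. Qed.

Lemma cisD2pin t n : cis (t + n%:R * (2 * pi)) = cis t.
Proof.
elim: n => [|n IHn]; first by rewrite mul0r addr0.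
by rewrite -natr1 mulrDl mul1r addrA cisD2pi.
Qed.

Lemma circle_mul_conj z : `|z| = 1 -> z * conjc z = 1.
Proof. by move=> z1; rewrite -sqr_normc z1 expr1n. Qed.

Lemma circle_cis z : `|z| = 1 -> exists t, z = cis t.
Proof.
case: z => x y /(congr1 (fun u => u ^+ 2)); rewrite expr1n -add_Re2_Im2/=.
move=> /complexI xy1.
have x1 : -1 <= x <= 1 by apply/andP; split; have := sqr_ge0 y; nra.
have cx : cos (acos x) = x by rewrite acosK// in_itv.
have : y ^+ 2 = sin (acos x) ^+ 2 by rewrite sin2cos2 cx; lra.
move=> /eqP; rewrite eqf_sqr => /orP[] /eqP ->.
  by exists (acos x); rewrite /cis cx.
by exists (- acos x); rewrite /cis cosN sinN cx.
Qed.

Lemma cis_inj s t : `|s - t| < 2 * pi -> cis s = cis t -> s = t.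
Proof.
move=> st e; have : cis (s - t) = 1 by rewrite cisD cisN e mul_cis_conj.
set u := (s - t) / 2; have -> : s - t = u + u by rewrite /u; lra.
move=> [] ; rewrite cosD -!expr2 cos2sin2 => e1 _.
have su : sin u = 0 by apply/eqP; rewrite -sqrf_eq0; apply/eqP; lra.
move: st; rewrite ltr_norml => /andP[h1 h2].
have pi0 := pi_gt0 R.
case: (ltrgtP u 0) => hu; last by rewrite /u in hu; lra.
- have : 0 < sin (- u) by apply: sin_gt0_pi; rewrite /u in hu *; lra.
  by rewrite sinN su oppr0 ltxx.
- have : 0 < sin u by apply: sin_gt0_pi; rewrite /u in hu *; lra.
  by rewrite su ltxx.
Qed.

(** For w = x + iy in the right half-plane, atan (y / x) is the argument of w, and w over its
    conjugate has twice that argument. *)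
Lemma cis_double_atan (x y : R) : 0 < x ->
  cis (2 * atan (y / x)) * (x -i* y) = x +i* y.
Proof.
move=> x0; have -> : y = (y / x) * x by rewrite divfK// gt_eqF.
rewrite mulfK ?gt_eqF//; move: (y / x) => r {y}.
have c2 : cos (atan r) ^+ 2 * (1 + r ^+ 2) = 1.
  have h : 0 < 1 + r ^+ 2 by rewrite ltr_wpDr ?sqr_ge0.
  by rewrite cos_atan exprVn sqr_sqrtr ?ltW// mulVf// gt_eqF.
have c0 : cos (atan r) != 0.
  apply/eqP => c0; move: c2; rewrite c0 expr0n/= mul0r => /eqP.
  by rewrite eq_sym oner_eq0.
have sE : sin (atan r) = r * cos (atan r).
  by rewrite -[X in X * _]atanK /tan divfK.
have -> : 2 * atan r = atan r + atan r by rewrite mulr_natl mulr2n.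
rewrite /cis cosD sinD sE; move: (cos _) c2 {sE c0} => c c2.
apply/eqP; rewrite eq_complex/=; apply/andP; split; apply/eqP.
  by rewrite -[RHS]mul1r -c2; ring.
by rewrite -[RHS]mul1r -c2; ring.
Qed.

End UnitCircle.

(** * Lifts of disk automorphisms to the line *)

Section MoebiusPhase.
Variable R : realType.
Local Notation C := R[i].
Implicit Types (s t : R) (a : C).

(** Real part of 1 - a e^{is}, [qim] being the imaginary part. For a in the disk it is positive, so
    atan of the quotient is a smooth argument. *)
Definition qre a s := 1 - (complex.Re a * cos s - complex.Im a * sin s).
Definition qim a s := - (complex.Re a * sin s + complex.Im a * cos s).

(* The lift to the line of the disk automorphism z |-> (z - conj a) / (1 - a z). *)
Definition mphase a s := s - 2 * atan (qim a s / qre a s).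

(** The Poisson kernel (1 - |a|^2) / |1 - a e^{is}|^2. *)
Definition dmphase a s :=
  (1 - complex.Re a ^+ 2 - complex.Im a ^+ 2) / (qre a s ^+ 2 + qim a s ^+ 2).

Lemma q_cis a s : 1 - a * cis s = qre a s +i* qim a s.
Proof.
case: a => x y; apply/eqP; rewrite eq_complex /qre /qim /cis /= eqxx/=.
by apply/eqP; ring.
Qed.

Lemma disk_Re_Im a : `|a| < 1 -> complex.Re a ^+ 2 + complex.Im a ^+ 2 < 1.
Proof.
by move=> a1; rewrite -ltcR add_Re2_Im2 expr_lt1// ?normr_ge0.
Qed.

Lemma qre_gt0 a s : `|a| < 1 -> 0 < qre a s.
Proof.
move=> /disk_Re_Im; rewrite /qre; have := cos2Dsin2 s.
move: (complex.Re a) (complex.Im a) (cos s) (sin s) => x y c d h1 h2.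
have := sqr_ge0 (x - c); have := sqr_ge0 (y + d); nra.
Qed.

(** On the circle e^{is} - conj a is e^{is} times the conjugate of 1 - a e^{is}, so only twice the
    argument of 1 - a e^{is} has to be subtracted from s. *)
Lemma cis_mphase a s : `|a| < 1 -> cis (mphase a s) * (1 - a * cis s) = cis s - conjc a.
Proof.
move=> a1; have q0 := qre_gt0 s a1; rewrite q_cis /mphase cisD -mulrA.
have -> : cis s - conjc a = cis s * conjc (1 - a * cis s).
  rewrite rmorphB rmorph1 rmorphM/= mulrBr mulr1 mulrCA.
  by rewrite mul_cis_conj mulr1.
congr (_ * _); rewrite q_cis -mulrN -atanN.
have := cis_double_atan (- qim a s) q0.
rewrite [- - qim a s]opprK [- qim a s / _]mulNr => ->.
by [].
Qed.

Lemma mphaseD2pi a s : mphase a (s + 2 * pi) = mphase a s + 2 * pi.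
Proof.
have e : 2 * pi = pi *+ 2 :> R by rewrite mulr_natl.
by rewrite /mphase /qre /qim e cosD2pi sinD2pi; ring.
Qed.

Lemma is_derive_qre a s : is_derive s 1 (qre a) (- qim a s).
Proof.
have hc := is_derive_mulf (is_derive_constf (complex.Re a) s) (is_derive_cos s).
have hs := is_derive_mulf (is_derive_constf (complex.Im a) s) (is_derive_sin s).
have h := is_derive_subf (is_derive_constf 1 s) (is_derive_subf hc hs).
apply: (is_derive_eq h). rewrite /qim; ring.
Qed.

Lemma is_derive_qim a s : is_derive s 1 (qim a) (qre a s - 1).
Proof.
have hs := is_derive_mulf (is_derive_constf (complex.Re a) s) (is_derive_sin s).
have hc := is_derive_mulf (is_derive_constf (complex.Im a) s) (is_derive_cos s).
have h := is_derive_subf (is_derive_constf 0 s) (is_derive_addf hs hc).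
rewrite (_ : qim a = fun s =>
    0 - (complex.Re a * sin s + complex.Im a * cos s)); last first.
  by apply/funext => u; rewrite sub0r.
by apply: (is_derive_eq h); rewrite /qre; ring.
Qed.

Lemma is_derive_mphase a s : `|a| < 1 ->
  is_derive s 1 (mphase a) (dmphase a s).
Proof.
move=> a1; have q0 := qre_gt0 s a1; have qn : qre a s != 0 by rewrite gt_eqF.
have dq := is_derive_mulf (is_derive_qim a s) (is_derive_invf qn (is_derive_qre a s)).
have h := is_derive_mulf (is_derive_constf 2 s)
  (is_derive_compf dq (is_derive1_atan (qim a s / qre a s))).
apply: (is_derive_eq (is_derive_subf (is_derive_id s 1) h)).
have e : complex.Re a ^+ 2 + complex.Im a ^+ 2 = (1 - qre a s) ^+ 2 + qim a s ^+ 2.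
  by rewrite /qre /qim -[LHS]mulr1 -(cos2Dsin2 s); ring.
have p0 : 0 < qre a s ^+ 2 + qim a s ^+ 2 by rewrite ltr_wpDr ?sqr_ge0 ?exprn_gt0.
have {}e : 1 - complex.Re a ^+ 2 - complex.Im a ^+ 2 =
    1 - (1 - qre a s) ^+ 2 - qim a s ^+ 2 by lra.
rewrite /dmphase e.
move: (qre a s) (qim a s) qn p0 => X Y X0 XY0; field; rewrite X0 gt_eqF//.
Qed.

Lemma dmphase_gt0 a s : `|a| < 1 -> 0 < dmphase a s.
Proof.
move=> a1; have q0 := qre_gt0 s a1; have := disk_Re_Im a1 => h.
apply: divr_gt0; first by lra.
by rewrite ltr_wpDr ?sqr_ge0 ?exprn_gt0.
Qed.

End MoebiusPhase.

(** * The phase of the Szego recursion on the circle *)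

Section SzegoPhase.
Variables (R : realType) (alpha : nat -> R[i]).
Local Notation C := R[i].
Implicit Types (s t : R) (z : C).

(* On the circle, z Phi_k(z) = e^{i szphase k t} Phi_k^*(z) for z = e^{it}. *)
Fixpoint szphase (k : nat) t : R :=
  if k is j.+1 then t + mphase (alpha j) (szphase j t) else t.

Fixpoint dszphase (k : nat) t : R :=
  if k is j.+1 then 1 + dszphase j t * dmphase (alpha j) (szphase j t) else 1.

Lemma is_derive_szphase k t : (forall j, (j < k)%N -> `|alpha j| < 1) ->
  is_derive t 1 (szphase k) (dszphase k t).
Proof.
elim: k => [|k IHk] a1 /=; first exact: is_derive_id.
have IH := IHk (fun j jk => a1 j (ltnW jk)).
exact: (is_derive_addf (is_derive_id t 1)
  (is_derive_compf IH (is_derive_mphase _ (a1 k (ltnSn k))))).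
Qed.

(** The factor z alone contributes 1 and the automorphisms preserve orientation. The uniform bound
    makes the phase invertible on the whole line. *)
Lemma dszphase_ge1 k t : (forall j, (j < k)%N -> `|alpha j| < 1) ->
  1 <= dszphase k t.
Proof.
elim: k => [//|k IHk] a1 /=; have IH := IHk (fun j jk => a1 j (ltnW jk)).
rewrite lerDl mulr_ge0//; first exact: le_trans IH.
exact/ltW/dmphase_gt0/a1.
Qed.

Lemma szphaseD2pi k t : szphase k (t + 2 * pi) = szphase k t + k.+1%:R * (2 * pi).
Proof.
elim: k => [|k IHk] /=; first by rewrite mul1r.
have mD n s : mphase (alpha k) (s + n%:R * (2 * pi)) =
    mphase (alpha k) s + n%:R * (2 * pi).
  elim: n => [|n IHn]; first by rewrite mul0r !addr0.
  by rewrite -natr1 mulrDl mul1r addrA mphaseD2pi IHn -addrA.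
by rewrite IHk mD -[k.+2%:R]natr1; ring.
Qed.

(** The phase involves atan, but its cosine and sine pass rationally through each automorphism, with
    a nowhere vanishing denominator. *)
Lemma ode_function_szphase k : (forall j, (j < k)%N -> `|alpha j| < 1) ->
  [/\ ode_function (fun t => cos (szphase k t)),
      ode_function (fun t => sin (szphase k t)) & ode_function (dszphase k)].
Proof.
have [oc os] := ode_function_cos_sin R.
elim: k => [|k IHk] a1 /=; first by split => //; exact: ode_function_cst.
have [hc hs hd] := IHk (fun j jk => a1 j (ltnW jk)).
have ak : `|alpha k| < 1 by exact: a1.
pose X t := qre (alpha k) (szphase k t); pose Y t := qim (alpha k) (szphase k t).
have oX : ode_function X.
  apply: ode_function_sub; first exact: ode_function_cst.
  by apply: ode_function_sub; apply: ode_function_mul => //; exact: ode_function_cst.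
have oY : ode_function Y.
  apply: ode_function_opp.
  by apply: ode_function_add; apply: ode_function_mul => //; exact: ode_function_cst.
have D0 t : X t ^+ 2 + Y t ^+ 2 != 0.
  by rewrite gt_eqF// ltr_wpDr ?sqr_ge0// exprn_gt0// qre_gt0.
have oD : ode_function (fun t => (X t ^+ 2 + Y t ^+ 2)^-1).
  apply: ode_function_inv => //.
  by apply: ode_function_add; apply: ode_function_mul.
have mE t : cis (mphase (alpha k) (szphase k t)) =
    (cis (szphase k t) - conjc (alpha k)) * (X t -i* Y t) * ((X t ^+ 2 + Y t ^+ 2)^-1)%:C.
  rewrite -(cis_mphase _ ak) q_cis -/(X t) -/(Y t) -!mulrA.
  rewrite -[LHS]mulr1; congr (_ * _); move: (X t) (Y t) (D0 t) => x y d.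
  by apply/eqP; rewrite eq_complex /=; apply/andP; split; apply/eqP; field.
pose U t := cos (szphase k t) - complex.Re (alpha k).
pose V t := sin (szphase k t) + complex.Im (alpha k).
have oU : ode_function U.
  by apply: ode_function_sub => //; exact: ode_function_cst.
have oV : ode_function V.
  by apply: ode_function_add => //; exact: ode_function_cst.
have cE t : cos (mphase (alpha k) (szphase k t)) =
    (U t * X t + V t * Y t) * (X t ^+ 2 + Y t ^+ 2)^-1.
  move/(congr1 (@complex.Re R)): (mE t) => /= ->.
  rewrite /U /V /cis; move: (X t) (Y t) (_^-1) => x y d.
  by case: (alpha k) => p q /=; ring.
have sE t : sin (mphase (alpha k) (szphase k t)) =
    (V t * X t - U t * Y t) * (X t ^+ 2 + Y t ^+ 2)^-1.
  move/(congr1 (@complex.Im R)): (mE t) => /= ->.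
  rewrite /U /V /cis; move: (X t) (Y t) (_^-1) => x y d.
  by case: (alpha k) => p q /=; ring.
have om : ode_function (fun t => cos (mphase (alpha k) (szphase k t))).
  under eq_fun do rewrite cE; apply: ode_function_mul => //.
  by apply: ode_function_add; apply: ode_function_mul.
have on : ode_function (fun t => sin (mphase (alpha k) (szphase k t))).
  under eq_fun do rewrite sE; apply: ode_function_mul => //.
  by apply: ode_function_sub; apply: ode_function_mul.
split.
- under eq_fun do rewrite cosD.
  by apply: ode_function_sub; apply: ode_function_mul.
- under eq_fun do rewrite sinD.
  by apply: ode_function_add; apply: ode_function_mul.
- apply: ode_function_add; first exact: ode_function_cst.
  apply: ode_function_mul => //; apply: ode_function_mul => //.
  exact: ode_function_cst.
Qed.

Lemma horner_revpoly k (p : {poly C}) z : `|z| = 1 -> (size p <= k.+1)%N ->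
  (revpoly k p).[z] = z ^+ k * conjc (p.[z]).
Proof.
move=> z1 sp; rewrite horner_poly (horner_coef_wide _ sp) rmorph_sum/= mulr_sumr.
rewrite (reindex_inj rev_ord_inj)/=; apply: eq_bigr => i _.
have ik : (i <= k)%N by rewrite -ltnS.
have -> : z ^+ k = z ^+ (k - i) * z ^+ i by rewrite -exprD subnK.
rewrite subSS subKn// rmorphM rmorphXn/=.
rewrite mulrC -!mulrA; congr (_ * _); rewrite mulrCA -exprMn circle_mul_conj//.
by rewrite expr1n mulr1.
Qed.

Local Notation rPhi k := (revpoly k (Phi alpha k)).

Lemma horner_PhiS k z :
  (Phi alpha k.+1).[z] = z * (Phi alpha k).[z] - conjc (alpha k) * (rPhi k).[z].
Proof. by rewrite /= hornerD hornerN hornerZ hornerM hornerX. Qed.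

Lemma horner_rPhiS k z : `|z| = 1 ->
  (rPhi k.+1).[z] = (rPhi k).[z] - alpha k * (z * (Phi alpha k).[z]).
Proof.
move=> z1; rewrite !horner_revpoly// ?size_Phi// horner_PhiS horner_revpoly ?size_Phi//.
rewrite rmorphB !rmorphM/= !conjcK rmorphXn/=.
have zc := circle_mul_conj z1; have zk : z ^+ k * conjc z ^+ k = 1.
  by rewrite -exprMn zc expr1n.
rewrite exprSr mulrBr; congr (_ - _).
  by rewrite mulrACA -[RHS]mulr1 -zc; ring.
by rewrite -[RHS]mulr1 -zk; ring.
Qed.

(** By the two recursions b = z Phi_k / Phi_k^* becomes z (b - conj alpha_k) / (1 - alpha_k b); the
    denominator has positive real part on the circle. *)
Lemma Phi_szphase k t : (forall j, (j < k)%N -> `|alpha j| < 1) ->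
  (rPhi k).[cis t] != 0 /\
  cis t * (Phi alpha k).[cis t] = cis (szphase k t) * (rPhi k).[cis t].
Proof.
have z1 := norm_cis t; set z := cis t in z1 *.
elim: k => [|k IHk] a1.
  by rewrite horner_revpoly ?size_Phi//= hornerC conjc1 expr0 !mulr1 oner_eq0.
have [r0 e] := IHk (fun j jk => a1 j (ltnW jk)).
have ak := a1 k (ltnSn k).
rewrite horner_rPhiS// horner_PhiS e; split.
  have -> : (rPhi k).[z] - alpha k * (cis (szphase k t) * (rPhi k).[z]) =
      (1 - alpha k * cis (szphase k t)) * (rPhi k).[z] by ring.
  rewrite mulf_neq0// q_cis; apply/eqP => -[h _].
  by have := qre_gt0 (szphase k t) ak; rewrite h ltxx.
rewrite [szphase k.+1 t]/= cisD -/z -mulrBl -[RHS]mulrA; congr (_ * _).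
by rewrite -(cis_mphase _ ak); ring.
Qed.

End SzegoPhase.

(** * Inversion of the phase *)

Section PopucZeros.
Variable R : realType.

(** A slope of at least [c] gives injectivity, and by intermediate values [y] is attained within |y
    - h 0| / c of the origin. *)
Lemma expanding_inverse (h dh : R -> R) (c : R) : 0 < c ->
  (forall t : R, is_derive t 1 h (dh t)) -> (forall t, c <= dh t) ->
  exists tau : R -> R, [/\ cancel tau h, cancel h tau &
    forall t : R, is_derive t 1 tau (dh (tau t))^-1].
Proof.
move=> c0 dhE dhc.
have grow a b : a <= b -> c * (b - a) <= h b - h a.
  move=> ab; have [x [_ _ ->]] := mean_value a b dhE.
  by rewrite ler_wpM2r// subr_ge0.
have ch t : {for t, continuous h} by exact: is_derive_cont (dhE t).
have surj y : exists t, h t = y.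
  pose M := `|y - h 0| / c.
  have M0 : 0 <= M by rewrite divr_ge0// ltW.
  have cM : c * M = `|y - h 0| by rewrite mulrC divfK// gt_eqF.
  have h1 : y <= h M.
    by have := grow 0 M M0; have := ler_norm (y - h 0); rewrite subr0 cM; lra.
  have h2 : h (- M) <= y.
    have := grow (- M) 0; rewrite oppr_le0 sub0r opprK cM => /(_ M0).
    by have := ler_norm (- (y - h 0)); rewrite normrN; lra.
  have cw : {within `[- M, M], continuous h} by exact: continuous_subspaceT.
  have [||t _ <-] := @IVT _ _ (- M) M y _ cw; first by lra.
    by rewrite ge_min h2 le_max h1 orbT.
  by exists t.
have [tau tauK] := choice surj.
have inj a b : h a = h b -> a = b.
  move=> hab; case: (leP a b) => ab.
    by have := grow a b ab; rewrite hab subrr; nra.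
  by have := grow b a (ltW ab); rewrite hab subrr; nra.
have htau : cancel h tau by move=> t; apply: inj; rewrite tauK.
exists tau; split=> // t.
have dn : dh (tau t) != 0 by rewrite gt_eqF// (lt_le_trans c0).
rewrite -[X in is_derive X](tauK t); apply: (is_derive_inverse _ _ (dhE _) dn).
  by near=> u; exact: htau.
by near=> u; exact: ch.
Unshelve. all: by end_near. Qed.

(** At a zero the phase is an argument of conj lambda. After division by n + 1, one turn of t is one
    turn of the zeros, and a shift of t by 2 pi / (n + 1) keeps lambda and moves to the next zero.
    The field [v] is the reciprocal of the derivative of the rescaled phase. *)
Lemma popuc_zero_phase (n : nat) (alpha : nat -> R[i]) :
  (forall j, (j < n)%N -> `|alpha j| < 1) ->
  exists v tau : R -> R,
    [/\ ode_function v, forall t, 0 < v t,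
        forall t : R, is_derive t 1 tau (v (tau t)),
        forall t, tau (t + 2 * pi) = tau t + 2 * pi &
        forall t k, root (popuc alpha n (conjc (cis (n.+1%:R * t))))
                         (cis (tau (t + k%:R * (2 * pi / n.+1%:R))))].
Proof.
move=> a1; have N0 : 0 < n.+1%:R :> R by rewrite ltr0n.
have Nn : n.+1%:R != 0 :> R by rewrite gt_eqF.
have Vn0 : 0 < n.+1%:R^-1 :> R by rewrite invr_gt0.
pose h t := szphase alpha n t * n.+1%:R^-1.
pose dh t := dszphase alpha n t * n.+1%:R^-1.
have dhE (t : R) : is_derive t 1 h (dh t).
  have := is_derive_mulf (is_derive_szphase t a1) (is_derive_constf n.+1%:R^-1 t).
  by move=> H; apply: (is_derive_eq H); rewrite mulr0 addr0.
have dh_ge t : n.+1%:R^-1 <= dh t by apply: ler_peMl; [exact: ltW|exact: dszphase_ge1].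
have [tau [tauK hK dtau]] := expanding_inverse Vn0 dhE dh_ge.
have dh0 t : 0 < dh t by exact: lt_le_trans (dh_ge t).
exists (fun t => (dh t)^-1), tau; split=> //.
- apply: ode_function_inv => [t|]; first by rewrite gt_eqF.
  apply: ode_function_mul; last exact: ode_function_cst.
  by have [] := ode_function_szphase a1.
- by move=> t; rewrite invr_gt0.
- move=> t; rewrite -[RHS]hK; congr tau; rewrite /h szphaseD2pi [RHS]mulrDl.
  by have := tauK t; rewrite /h => ->; rewrite mulrAC divff// mul1r.
- move=> t k; set s := t + _; rewrite rootE.
  have [_ e] := Phi_szphase (tau s) a1.
  rewrite /popuc hornerD hornerN hornerZ hornerM hornerX e.
  have -> : szphase alpha n (tau s) = n.+1%:R * s.
    by rewrite -[in RHS](tauK s) /h mulrCA divff// mulr1.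
  have cc (z : R[i]) : ((conjc z)^*)%R = z by exact: conjcK.
  rewrite cc /s mulrDr; have -> : n.+1%:R * (k%:R * (2 * pi / n.+1%:R)) =
     k%:R * (2 * pi) :> R by field.
  by rewrite cisD2pin subrr.
Qed.

End PopucZeros.

(** * Christoffel-Darboux and the two numerical ranges in coordinates *)

Section OrthonormalPolynomials.
Variables (R : realType) (n : nat) (alpha : nat -> R[i]).
Hypothesis alpha_disk : forall j, (j < n)%N -> `|alpha j| < 1.
Local Notation C := R[i].
Local Notation phi := (phi alpha).
Local Notation Phi := (Phi alpha).
Local Notation rPhi k := (revpoly k (Phi k)).
Implicit Types (p q : {poly C}) (x y z : C) (w : C -> R).

Definition nsq z : R := complex.Re z ^+ 2 + complex.Im z ^+ 2.

Lemma nsqE z : (nsq z)%:C = conjc z * z.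
Proof. by rewrite /nsq add_Re2_Im2 sqr_normc mulrC. Qed.

Lemma nsq_ge0 z : 0 <= nsq z.
Proof. by rewrite addr_ge0 ?sqr_ge0. Qed.

Lemma nsq_eq0 z : nsq z = 0 -> z = 0.
Proof.
case: z => a b /eqP; rewrite /nsq/= paddr_eq0 ?sqr_ge0// !sqrf_eq0.
by move=> /andP[/eqP -> /eqP ->].
Qed.

Lemma nsqM x y : nsq (x * y) = nsq x * nsq y.
Proof. by case: x => a b; case: y => c d; rewrite /nsq/=; ring. Qed.

Lemma nsq_gt0 z : z != 0 -> 0 < nsq z.
Proof.
move=> z0; rewrite lt_neqAle nsq_ge0 andbT eq_sym; apply/eqP => /nsq_eq0 e.
by rewrite e eqxx in z0.
Qed.

Definition norming (k : nat) : C := \prod_(j < k) rho alpha j.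

Lemma rho_real j : (j < n)%N ->
  [/\ rho alpha j != 0, conjc (rho alpha j) = rho alpha j &
      rho alpha j ^+ 2 = 1 - alpha j * conjc (alpha j)].
Proof.
move=> jn; have a1 := alpha_disk jn; rewrite /rho -sqr_normc.
have a2 : 0 < 1 - `|alpha j| ^+ 2 by rewrite subr_gt0 expr_lt1.
split; last by rewrite sqrtCK.
  by rewrite sqrtC_eq0 gt_eqF.
by apply: (@CrealP C); apply: ger0_real; rewrite sqrtC_ge0 ltW.
Qed.

Lemma norming_real k : (k <= n)%N ->
  norming k != 0 /\ conjc (norming k) = norming k.
Proof.
elim: k => [|k IHk] kn; first by rewrite /norming big_ord0 oner_eq0 conjc1.
have [h1 h2] := IHk (ltnW kn); have [h3 h4 _] := rho_real kn.
rewrite /norming big_ord_recr/= -/(norming k) mulf_neq0//; split => //.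
by rewrite rmorphM/= h2 h4.
Qed.

(** Inserting both recursions, the left side at k + 1 is 1 - |alpha_k|^2 times the left side at k,
    plus (1 - z conj x) Phi_{k+1}(z) conj Phi_{k+1}(x). The first factor is rho_k^2, which is what
    the squared norming constant gains. *)
Lemma christoffel_darboux k z x : `|z| = 1 -> `|x| = 1 -> (k <= n)%N ->
  (rPhi k).[z] * conjc ((rPhi k).[x])
    - z * conjc x * ((Phi k).[z] * conjc ((Phi k).[x])) =
  norming k ^+ 2 *
    ((1 - z * conjc x) * \sum_(j < k.+1) (phi j).[z] * conjc ((phi j).[x])).
Proof.
move=> z1 x1; elim: k => [|k IHk] kn.
  rewrite !horner_revpoly ?size_Phi//= !hornerC !conjc1 !expr0 !mulr1.
  rewrite big_ord_recl big_ord0 /phi !hornerZ !hornerC !mulr1 addr0 /norming.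
  by rewrite big_ord0 invr1 conjc1 expr1n !mul1r mulr1.
have [n1 n2] := norming_real kn; have [_ _ r2] := rho_real kn.
rewrite big_ord_recr/= mulrDr mulrDr.
have -> : norming k.+1 ^+ 2 * ((1 - z * conjc x) *
    \sum_(j < k.+1) (phi j).[z] * conjc ((phi j).[x])) =
   (1 - alpha k * conjc (alpha k)) *
   ((rPhi k).[z] * conjc ((rPhi k).[x])
    - z * conjc x * ((Phi k).[z] * conjc ((Phi k).[x]))).
  rewrite IHk ?(ltnW kn)// -r2 /norming big_ord_recr/= exprMn.
  by rewrite -mulrA mulrCA.
have -> : norming k.+1 ^+ 2 * ((1 - z * conjc x) *
    ((phi k.+1).[z] * conjc ((phi k.+1).[x]))) =
  (1 - z * conjc x) * ((Phi k.+1).[z] * conjc ((Phi k.+1).[x])).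
  rewrite /Defs.phi !hornerZ -/(norming k.+1) rmorphM/= conjc_inv n2.
  by field.
rewrite !horner_rPhiS// !horner_PhiS !rmorphB !rmorphM/= !conjcK.
by ring.
Qed.

Lemma phi_span k p : (k <= n.+1)%N -> (size p <= k)%N ->
  exists c : 'I_k -> C, p = \sum_i c i *: phi i.
Proof.
elim: k p => [|k IHk] p kn sp.
  by exists (fun=> 0); rewrite big_ord0; apply/eqP; rewrite -size_poly_leq0.
have [n0 _] := norming_real kn.
have sphi : size (phi k) = k.+1 by rewrite size_scale ?invr_eq0// size_Phi.
have lphi : (phi k)`_k != 0.
  by rewrite -[X in _`_X]/(k.+1.-1) -sphi -lead_coefE lead_coef_eq0 -size_poly_gt0 sphi.
pose a := p`_k / (phi k)`_k.
have [|c ce] := IHk (p - a *: phi k) (ltnW kn).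
  apply/leq_sizeP => j; rewrite leq_eqVlt coefB coefZ => /predU1P[<-|kj].
    by rewrite /a divfK// subrr.
  rewrite !nth_default ?mulr0 ?subr0// ?sphi//.
  exact: leq_trans sp kj.
exists (fun i => if unlift ord_max i is Some j then c j else a).
rewrite big_ord_recr/= unlift_none -[LHS](subrK (a *: phi k)) ce; congr (_ + _).
apply: eq_bigr => i _; rewrite (_ : widen_ord _ i = lift ord_max i) ?liftK//.
by apply: val_inj; rewrite /= /bump leqNgt ltn_ord.
Qed.

(** * The measure and the inner product carried by the zeros *)

Section Nodes.
Variables (lambda : C) (z : 'I_n.+1 -> C).
Hypothesis lambda_circle : `|lambda| = 1.
Hypothesis z_circle : forall i, `|z i| = 1.
Hypothesis z_inj : injective z.
Hypothesis z_root : forall i, root (popuc alpha n lambda) (z i).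

Lemma popuc_neq0 : popuc alpha n lambda != 0.
Proof. by rewrite -size_poly_gt0 size_popuc. Qed.

Lemma popuc_rootE x : root (popuc alpha n lambda) x -> exists i, x = z i.
Proof.
move=> rx; apply: contrapT => /forallNP nx.
have := @max_poly_roots _ (popuc alpha n lambda) (x :: codom z) popuc_neq0.
rewrite size_popuc /= size_codom card_ord ltnn => /(_ _ _)/implyP.
rewrite rx /=; have -> : all (root (popuc alpha n lambda)) (codom z).
  by apply/allP => y /codomP[i ->].
rewrite (map_inj_uniq z_inj) enum_uniq andbT.
have -> : x \notin codom z by apply/negP => /codomP[i /nx].
by move=> /(_ isT isT).
Qed.

Lemma L2_innerE w p q :
  (forall x, ~~ root (popuc alpha n lambda) x -> w x = 0) ->
  L2_inner w p q = \sum_i (w (z i))%:C * conjc (p.[z i]) * q.[z i].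
Proof.
move=> w0; rewrite /L2_inner (fsbigE (codom z)).
- rewrite big_mkcond/= /codom /image_mem big_map big_enum/=.
  by apply: eq_bigr => i _; rewrite in_setT.
- by rewrite (map_inj_uniq z_inj) enum_uniq.
- by [].
- move=> x _ xz; rewrite w0 ?rmorph0 ?mul0r//.
  by apply: contra xz => /popuc_rootE[i ->]; exact: codom_f.
Qed.

(** The Christoffel-Darboux kernel on the diagonal; its reciprocals at the nodes are the masses
    sought. *)
Definition kernel x : R := \sum_(j < n.+1) nsq ((phi j).[x]).

Lemma kernel_gt0 x : 0 < kernel x.
Proof.
rewrite /kernel big_ord_recl ltr_pwDl ?sumr_ge0// => [|i _]; last exact: nsq_ge0.
by rewrite /phi big_ord0 invr1 scale1r hornerC; apply: nsq_gt0; exact: oner_neq0.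
Qed.

(** At the nodes z Phi_n = conj lambda Phi_n^*, so the left side of Christoffel-Darboux vanishes,
    while 1 - z_i conj z_k does not for distinct nodes. *)
Lemma kernel_orth i k : i != k ->
  \sum_(j < n.+1) (phi j).[z i] * conjc ((phi j).[z k]) = 0.
Proof.
move=> ik; have := christoffel_darboux (z_circle i) (z_circle k) (leqnn n).
have rt l : z l * (Phi n).[z l] = conjc lambda * (rPhi n).[z l].
  have := z_root l; rewrite rootE /popuc hornerD hornerN hornerZ hornerM hornerX.
  by rewrite subr_eq0 => /eqP.
have -> : z i * conjc (z k) * ((Phi n).[z i] * conjc ((Phi n).[z k])) =
    (z i * (Phi n).[z i]) * conjc (z k * (Phi n).[z k]).
  by rewrite rmorphM/=; ring.
rewrite !rt rmorphM/= conjcK.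
have -> : conjc lambda * (rPhi n).[z i] * (lambda * conjc ((rPhi n).[z k])) =
  (lambda * conjc lambda) * ((rPhi n).[z i] * conjc ((rPhi n).[z k])) by ring.
rewrite circle_mul_conj// mul1r subrr => /esym/eqP.
have [n1 _] := norming_real (leqnn n).
rewrite mulf_eq0 sqrf_eq0 (negbTE n1)/= mulf_eq0 => /orP[|/eqP//].
rewrite subr_eq0 => /eqP e; exfalso; move/eqP: ik; apply; apply: z_inj.
rewrite -[LHS]mulr1 -(circle_mul_conj (z_circle k)) mulrCA -e mulr1//.
Qed.

Definition christoffel_weight x : R :=
  if root (popuc alpha n lambda) x then (kernel x)^-1 else 0.

(** The kernel identities read A B = 1 for square matrices of values; hence B A = 1, which is
    orthonormality for the weights. *)
Lemma christoffel_orthonormal j k : (j <= n)%N -> (k <= n)%N ->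
  L2_inner christoffel_weight (phi j) (phi k) = (j == k)%:R.
Proof.
move=> jn kn; rewrite L2_innerE; last first.
  by move=> x /negbTE h; rewrite /christoffel_weight h.
pose A := \matrix_(i < n.+1, l < n.+1) ((kernel (z i))^-1%:C * conjc ((phi l).[z i])).
pose B := \matrix_(l < n.+1, i < n.+1) (phi l).[z i].
have AB : A *m B = 1%:M.
  apply/matrixP => i i'; rewrite !mxE.
  under eq_bigr do rewrite !mxE -mulrA.
  rewrite -mulr_sumr; case: eqVneq => [<-|ii'] /=; last first.
    rewrite (eq_bigr (fun j0 : 'I_n.+1 => (phi j0).[z i'] * conjc ((phi j0).[z i]))).
      by rewrite kernel_orth ?mulr0// eq_sym.
    by move=> l _; rewrite mulrC.
  rewrite (eq_bigr (fun j0 : 'I_n.+1 => (nsq ((phi j0).[z i]))%:C)); last first.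
    by move=> l _; rewrite nsqE.
  rewrite -rmorph_sum/= -/(kernel (z i)) -rmorphM/= mulVf ?rmorph1//.
  by rewrite gt_eqF// kernel_gt0.
have /matrixP/(_ (inord k) (inord j)) := mulmx1C AB.
rewrite !mxE -val_eqE/= !inordK ?ltnS// eq_sym => <-.
apply: eq_bigr => i _; rewrite !mxE !inordK ?ltnS// /christoffel_weight z_root.
by rewrite mulrC.
Qed.

Lemma christoffel_measure : is_popuc_measure alpha n lambda christoffel_weight.
Proof.
have w0 x : ~~ root (popuc alpha n lambda) x -> christoffel_weight x = 0.
  by move=> /negbTE h; rewrite /christoffel_weight h.
split=> //.
- by move=> x rx; rewrite /christoffel_weight rx invr_gt0 kernel_gt0.
(* The total mass is the squared norm of [phi 0], the constant 1. *)
- have := christoffel_orthonormal (leq0n n) (leq0n n); rewrite L2_innerE//.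
  have p0 x : (phi 0).[x] = 1 by rewrite /phi big_ord0 invr1 scale1r hornerC.
  under eq_bigr do rewrite !p0 conjc1 !mulr1.
  rewrite -rmorph_sum/= => /complexI <-.
  rewrite (fsbigE (codom z)) ?(map_inj_uniq z_inj) ?enum_uniq//.
    rewrite big_mkcond/= /codom /image_mem big_map big_enum/=.
    by apply: eq_bigr => i _; rewrite in_setT.
  move=> x _ xz; rewrite w0//.
  by apply: contra xz => /popuc_rootE[i ->]; exact: codom_f.
- exact: christoffel_orthonormal.
Qed.

Local Notation mu := (popuc_measure alpha n lambda).
Local Notation ip := (inner alpha n lambda).

Lemma popuc_measureP : is_popuc_measure alpha n lambda mu.
Proof. by apply: xgetPex; exists christoffel_weight; exact: christoffel_measure. Qed.

Lemma innerE p q : ip p q = \sum_i (mu (z i))%:C * conjc (p.[z i]) * q.[z i].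
Proof. by rewrite /inner L2_innerE//; have [] := popuc_measureP. Qed.

Lemma mu_gt0 i : 0 < mu (z i).
Proof. by have [h _ _ _] := popuc_measureP; exact: h. Qed.

Lemma inner_phi j k : (j <= n)%N -> (k <= n)%N -> ip (phi j) (phi k) = (j == k)%:R.
Proof. by have [_ _ _] := popuc_measureP; exact. Qed.

Lemma innerDZr p q r c : ip p (c *: q + r) = c * ip p q + ip p r.
Proof.
rewrite !innerE mulr_sumr -big_split/=; apply: eq_bigr => i _.
by rewrite hornerD hornerZ mulrDr; congr (_ + _); rewrite mulrCA.
Qed.

Lemma inner_conj p q : conjc (ip p q) = ip q p.
Proof.
rewrite !innerE rmorph_sum/=; apply: eq_bigr => i _.
by rewrite !rmorphM/= conjcK oppr0 -/((mu (z i))%:C) mulrAC.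
Qed.

Lemma inner_sumr (I : finType) p (f : I -> {poly C}) (c : I -> C) :
  ip p (\sum_i c i *: f i) = \sum_i c i * ip p (f i).
Proof.
elim/big_rec2 : _ => [|i x q _ <-]; last by rewrite innerDZr.
by rewrite innerE big1// => i _; rewrite horner0 mulr0.
Qed.

(** The inner product reads only coefficients in the basis [phi i], hence is the same for every
    lambda. *)
Lemma inner_sums (c d : 'I_n.+1 -> C) :
  ip (\sum_i c i *: phi i) (\sum_i d i *: phi i) = \sum_i conjc (c i) * d i.
Proof.
rewrite inner_sumr; apply: eq_bigr => i _.
rewrite -inner_conj inner_sumr rmorph_sum/= (bigD1 i)//= big1 => [|j ji].
  by rewrite (inner_phi (leq_ord i) (leq_ord i)) eqxx mulr1 addr0 mulrC.
by rewrite (inner_phi (leq_ord i) (leq_ord j)) eq_sym val_eqE (negbTE ji) mulr0 conjc0.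
Qed.

Lemma inner_phi_lt p : polys n p -> ip (phi n) p = 0.
Proof.
move=> /(phi_span (leqnSn n))[c ->]; rewrite inner_sumr big1// => i _.
by rewrite inner_phi ?(ltnW (ltn_ord i))// gtn_eqF ?mulr0.
Qed.

(** For deg p < n the product z p has degree at most n and is not reduced modulo the POPUC; the
    projection then removes a multiple of [phi n], orthogonal to p. *)
Lemma inner_compressed p : polys n p ->
  ip p (compressed alpha n lambda p) = ip p ('X * p).
Proof.
move=> pn; have projp : Defs.proj alpha n lambda p = p.
  by rewrite /Defs.proj inner_phi_lt// scale0r subr0.
rewrite /compressed projp /mulz modp_small; last first.
  rewrite size_popuc (leq_ltn_trans (size_polyMleq _ _))// size_polyX.
  by rewrite ltnS.
have e : inner alpha n lambda p (phi n) = 0.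
  by rewrite -inner_conj inner_phi_lt// conjc0.
by rewrite /Defs.proj -scaleNr addrC innerDZr e mulr0 add0r.
Qed.

Definition node_poly i : {poly C} := \prod_(k | k != i) ('X - (z k)%:P).

Lemma size_node_poly i : size (node_poly i) = n.+1.
Proof.
rewrite /node_poly -big_filter size_prod_XsubC size_filter -sum1_count.
by rewrite (sum1_card (predC1 i)) cardC1 card_ord.
Qed.

Lemma node_poly_monic i : node_poly i \is monic.
Proof. by apply: monic_prod => k _; exact: monicXsubC. Qed.

Lemma node_poly_eq0 i k : k != i -> (node_poly i).[z k] = 0.
Proof. by move=> ki; rewrite horner_prod (bigD1 k)//= hornerXsubC subrr mul0r. Qed.

Lemma node_poly_neq0 i : (node_poly i).[z i] != 0.
Proof.
rewrite horner_prod prodf_seq_neq0; apply/allP => k _; apply/implyP => ki.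
by rewrite hornerXsubC subr_eq0 (inj_eq z_inj) eq_sym.
Qed.

Definition interp (c : 'I_n.+1 -> C) : {poly C} :=
  \sum_i (c i / (node_poly i).[z i]) *: node_poly i.

Lemma interp_polys c : polys n.+1 (interp c).
Proof.
apply: (leq_trans (size_sum _ _ _)); apply/bigmax_leqP => i _.
by rewrite (leq_trans (size_scale_leq _ _))// size_node_poly.
Qed.

Lemma interpE c k : (interp c).[z k] = c k.
Proof.
rewrite horner_sum (bigD1 k)//= big1 ?addr0 => [|i ik].
  by rewrite hornerZ divfK// node_poly_neq0.
have ki : k != i by rewrite eq_sym.
by rewrite hornerZ (node_poly_eq0 ki) mulr0.
Qed.

Lemma interpK p : polys n.+1 p -> interp (fun i => p.[z i]) = p.
Proof.
move=> pn; apply/eqP; rewrite -subr_eq0; apply/eqP.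
apply: (@roots_geq_poly_eq0 _ _ (codom z)).
- apply/allP => _ /codomP[i ->].
  by rewrite rootE hornerD hornerN interpE subrr.
- by rewrite (map_inj_uniq z_inj) enum_uniq.
- rewrite size_codom card_ord (leq_trans (size_polyD _ _))// size_polyN geq_max pn.
  by rewrite andbT interp_polys.
Qed.

Lemma coef_interp c : (interp c)`_n = \sum_i c i / (node_poly i).[z i].
Proof.
rewrite coef_sum; apply: eq_bigr => i _; rewrite coefZ.
have /monicP := node_poly_monic i; rewrite lead_coefE size_node_poly => ->.
by rewrite mulr1.
Qed.

Lemma polysS_coef p : polys n.+1 p -> (polys n p <-> p`_n = 0).
Proof.
move=> pn; split=> [/leq_sizeP|p0]; first exact.
apply/leq_sizeP => j; rewrite leq_eqVlt => /predU1P[<-//|nj].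
by move: pn => /leq_sizeP; exact.
Qed.

Lemma inner_self p : ip p p = (\sum_i mu (z i) * nsq (p.[z i]))%:C.
Proof.
rewrite innerE rmorph_sum/=; apply: eq_bigr => i _.
by rewrite -mulrA -nsqE -rmorphM.
Qed.

Lemma inner_shift p q : (forall i, q.[z i] = z i * p.[z i]) ->
  ip p q = \sum_i (mu (z i) * nsq (p.[z i]))%:C * z i.
Proof.
move=> qp; rewrite innerE; apply: eq_bigr => i _.
by rewrite rmorphM/= nsqE qp; ring.
Qed.

(* Rescaling the values of a polynomial at the nodes by its Lagrange
   coefficients turns the condition deg < n into "the coordinates sum to 0". *)
Definition node_range (G : 'I_n.+1 -> R) : set C :=
  [set \sum_i (G i * nsq (d i))%:C * z i |
    d in [set d : 'I_n.+1 -> C | \sum_i d i = 0 /\ \sum_i G i * nsq (d i) = 1]].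

(** The coordinates are d_i = p(z_i) / L_i, with L_i the value at z_i of the i-th node polynomial.
    Node polynomials are monic of degree n, so the d_i add up to the coefficient of degree n of p;
    the weights mu(z_i) |L_i|^2 absorb the rescaling. *)
Lemma inner_range_coords : exists G : 'I_n.+1 -> R, (forall i, 0 < G i) /\
  [set ip p ('X * p) | p in [set p | polys n p /\ ip p p = 1]] = node_range G.
Proof.
pose L i := (node_poly i).[z i]; have L0 i : L i != 0 by exact: node_poly_neq0.
pose G i := mu (z i) * nsq (L i).
exists G; split; first by move=> i; rewrite mulr_gt0 ?mu_gt0// nsq_gt0.
have key p d : (forall i, p.[z i] = d i * L i) ->
    ip p ('X * p) = \sum_i (G i * nsq (d i))%:C * z i /\
    ip p p = (\sum_i G i * nsq (d i))%:C.
  move=> pd; have GE i : mu (z i) * nsq (p.[z i]) = G i * nsq (d i).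
    by rewrite pd nsqM mulrCA mulrC.
  split; last by rewrite inner_self; under eq_bigr do rewrite GE.
  rewrite inner_shift => [|i]; last by rewrite hornerM hornerX.
  by under eq_bigr do rewrite GE.
apply/seteqP; split=> [_ [p [pn p1] <-]|_ [d [d0 d1] <-]].
- have pn1 : polys n.+1 p by exact: leq_trans (leqnSn n).
  have pd i : p.[z i] = (p.[z i] / L i) * L i by rewrite divfK.
  have [-> e] := key p (fun i => p.[z i] / L i) pd.
  exists (fun i => p.[z i] / L i) => //; split; last first.
    by apply: complexI; rewrite -e p1.
  by rewrite -(coef_interp (fun i => p.[z i])) interpK//; apply/polysS_coef.
- pose p := interp (fun i => d i * L i).
  have [e1 e2] := key p d (interpE _); exists p => //; split; last first.
    by rewrite e2 d1.
  apply/(polysS_coef (interp_polys _)); rewrite coef_interp -[RHS]d0.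
  by apply: eq_bigr => i _; rewrite mulfK.
Qed.

(** The numbers mu(z_i) |p(z_i)|^2 are barycentric weights; conversely weights t_i come from
    interpolating the square roots of t_i / mu(z_i). *)
Lemma NU_hull : NU alpha n lambda = hull z.
Proof.
apply/seteqP; split=> [_ [p [pn p1] <-]|_ [t [t0 t1] <-]].
- rewrite (inner_shift (fun i => mulz_horner _ (z_root i))).
  exists (fun i => mu (z i) * nsq (p.[z i])) => //; split.
    by move=> i; rewrite mulr_ge0 ?nsq_ge0// ltW// mu_gt0.
  by apply: complexI; rewrite -inner_self p1.
- pose p := interp (fun i => (Num.sqrt (t i / mu (z i)))%:C).
  have pe i : mu (z i) * nsq (p.[z i]) = t i.
    rewrite interpE /nsq /= expr0n addr0 sqr_sqrtr ?divr_ge0// ?ltW ?mu_gt0//.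
    by rewrite mulrC divfK// gt_eqF// mu_gt0.
  exists p; first split; first exact: interp_polys.
    by rewrite inner_self; under eq_bigr do rewrite pe; rewrite t1.
  rewrite (inner_shift (fun i => mulz_horner _ (z_root i))).
  by apply: eq_bigr => i _; rewrite pe.
Qed.

End Nodes.
End OrthonormalPolynomials.

(** * From the polynomials to plane geometry *)

Section PopucGeometry.
Variables (R : realType) (n : nat) (alpha : nat -> R[i]).
Hypothesis alpha_disk : forall j, (j < n)%N -> `|alpha j| < 1.
Local Notation C := R[i].

Definition popuc_nodes (lambda : C) (z : 'I_n.+1 -> C) :=
  [/\ `|lambda| = 1, forall i, `|z i| = 1, injective z &
      forall i, root (popuc alpha n lambda) (z i)].

Lemma inner_indep lambda lambda' z z' p q :
  popuc_nodes lambda z -> popuc_nodes lambda' z' ->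
  polys n.+1 p -> polys n.+1 q ->
  inner alpha n lambda p q = inner alpha n lambda' p q.
Proof.
move=> [l1 z1 zi zr] [l1' z1' zi' zr'].
move=> /(phi_span alpha_disk (leqnn _))[c ->] /(phi_span alpha_disk (leqnn _))[d ->].
by rewrite (inner_sums alpha_disk l1 z1 zi zr) (inner_sums alpha_disk l1' z1' zi' zr').
Qed.

(** Computed from [lambda0], N(A) is expressed with the zeros of any other POPUC; so each line of
    the family is studied in coordinates for which it joins two nodes. *)
Lemma NA_coords lambda0 z0 lambda z :
  popuc_nodes lambda0 z0 -> popuc_nodes lambda z ->
  exists G : 'I_n.+1 -> R, (forall i, 0 < G i) /\
    NA alpha n lambda0 = node_range z G.
Proof.
move=> nd0 nd; have [l0 z01 zi0 zr0] := nd0; have [l1 z1 zi zr] := nd.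
have [G [G0 e]] := inner_range_coords alpha_disk l1 z1 zi zr.
exists G; split=> //; rewrite -e /NA /numerical_range.
have pS p : polys n p -> polys n.+1 p by move=> h; exact: leq_trans (leqnSn n).
have pX p : polys n p -> polys n.+1 ('X * p).
  by move=> h; rewrite /polys/= (leq_trans (size_polyMleq _ _))// size_polyX.
have cE p : polys n p -> inner alpha n lambda0 p (compressed alpha n lambda0 p) =
    inner alpha n lambda p ('X * p).
  move=> h; rewrite (inner_compressed alpha_disk l0 z01 zi0 zr0)//.
  by apply: (inner_indep nd0 nd); [exact: pS|exact: pX].
have sE p : polys n p -> inner alpha n lambda0 p p = inner alpha n lambda p p.
  by move=> h; apply: (inner_indep nd0 nd); exact: pS.
apply/seteqP; split=> [_ [p [pn p1] <-]|_ [p [pn p1] <-]].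
  by exists p; [split=> //; rewrite -sE|rewrite cE].
by exists p; [split=> //; rewrite sE|rewrite cE].
Qed.

Definition popuc_zero (tau : R -> R) (t : R) (i : 'I_n.+1) : C :=
  cis (tau (t + i%:R * (2 * pi / n.+1%:R))).

Lemma popuc_geometry (lambda0 : C) : `|lambda0| = 1 -> exists v tau : R -> R,
  [/\ ode_function v, forall t, 0 < v t,
      forall t : R, is_derive t 1 tau (v (tau t)) &
      forall t, tau (t + 2 * pi) = tau t + 2 * pi] /\
  [/\ forall lambda : C, `|lambda| = 1 ->
        exists t, NU alpha n lambda = hull (popuc_zero tau t) /\
          injective (popuc_zero tau t),
      forall t, exists2 lambda, `|lambda| = 1 &
        NU alpha n lambda = hull (popuc_zero tau t) &
      forall t, exists G : 'I_n.+1 -> R, (forall i, 0 < G i) /\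
        NA alpha n lambda0 = node_range (popuc_zero tau t) G].
Proof.
move=> l0; have [v [tau [ov v0 dtau tau2 zr]]] := popuc_zero_phase alpha_disk.
exists v, tau; split=> //.
have N0 : 0 < n.+1%:R :> R by rewrite ltr0n.
have cnorm (z : C) : `|z| = 1 -> `|conjc z| = 1.
  by move=> z1; rewrite -[LHS](normcJ (conjc z)) conjcK.
have tau_lt a b : a < b -> tau a < tau b.
  move=> ab; have [c [_ _ e]] := mean_value a b dtau.
  by rewrite -subr_gt0 e mulr_gt0// subr_gt0.
pose l (t : R) : C := conjc (cis (n.+1%:R * t)).
have nodes t : popuc_nodes (l t) (popuc_zero tau t).
  split=> [||i j /cis_inj e|i].
  - exact/cnorm/norm_cis.
  - by move=> i; exact: norm_cis.
  - set w := 2 * pi / n.+1%:R in e.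
    have w0 : 0 < w by rewrite divr_gt0// mulr_gt0// pi_gt0.
    have wN : n.+1%:R * w = 2 * pi by rewrite mulrC divfK// gt_eqF.
    (* All n + 1 phases lie in one turn starting at [tau t], where [cis] is injective. *)
    have bnd (k : 'I_n.+1) : tau t <= tau (t + k%:R * w) < tau t + 2 * pi.
      rewrite -tau2; apply/andP; split; last first.
        by apply: tau_lt; rewrite ltrD2l -wN ltr_pM2r// ltr_nat.
      have [->|k0] := eqVneq (k : nat) 0%N; first by rewrite mul0r addr0.
      by apply/ltW/tau_lt; rewrite ltrDl mulr_gt0// ltr0n lt0n.
    have h : `|tau (t + i%:R * w) - tau (t + j%:R * w)| < 2 * pi.
      have := bnd i; have := bnd j => /andP[h1 h2] /andP[h3 h4].
      by rewrite ltr_norml; apply/andP; split; lra.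
    apply: val_inj => /=; case: (ltngtP i j) => // ij.
      have : tau (t + i%:R * w) < tau (t + j%:R * w).
        by apply: tau_lt; rewrite ltrD2l ltr_pM2r// ltr_nat.
      by rewrite (e h) ltxx.
    have : tau (t + j%:R * w) < tau (t + i%:R * w).
      by apply: tau_lt; rewrite ltrD2l ltr_pM2r// ltr_nat.
    by rewrite (e h) ltxx.
  - exact: zr.
have lam lambda : `|lambda| = 1 -> exists t, lambda = l t.
  move=> l1; have [s e] := circle_cis (cnorm _ l1).
  by exists (s / n.+1%:R); rewrite /l mulrC divfK ?gt_eqF// -e conjcK.
have NUE t : NU alpha n (l t) = hull (popuc_zero tau t).
  by have [l1 z1 zi zr'] := nodes t; apply: NU_hull.
split.
- move=> lambda /lam[t ->]; exists t; split; first exact: NUE.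
  by have [] := nodes t.
- by move=> t; exists (l t); [exact/cnorm/norm_cis|exact: NUE].
- by move=> t; have [s ->] := lam _ l0; exact: NA_coords (nodes s) (nodes t).
Qed.

End PopucGeometry.

(** * Convexity *)

Section ToeplitzHausdorff.
Variables (R : realType) (n : nat) (z : 'I_n.+1 -> R[i]) (G : 'I_n.+1 -> R).
Hypothesis G_gt0 : forall i, 0 < G i.
Local Notation C := R[i].
Implicit Types (d e c : 'I_n.+1 -> C).

Definition mass d : R := \sum_i G i * nsq (d i).
Definition moment d : C := \sum_i (G i * nsq (d i))%:C * z i.

Lemma mass_ge0 d : 0 <= mass d.
Proof. by apply: sumr_ge0 => i _; rewrite mulr_ge0 ?nsq_ge0// ltW. Qed.

Lemma mass_eq0 d i : mass d = 0 -> d i = 0.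
Proof.
move=> /eqP; rewrite psumr_eq0 => [/allP/(_ i (mem_index_enum _))/=|j _]; last first.
  by rewrite mulr_ge0 ?nsq_ge0// ltW.
by rewrite mulf_eq0 gt_eqF//= => /eqP/nsq_eq0.
Qed.

Lemma node_range_cone d : \sum_i d i = 0 -> 0 < mass d ->
  node_range z G ((mass d)^-1%:C * moment d).
Proof.
move=> d0 m0; pose k : C := (Num.sqrt (mass d)^-1)%:C.
have nk : nsq k = (mass d)^-1.
  by rewrite /nsq/= expr0n addr0 sqr_sqrtr// invr_ge0 ltW.
exists (fun i => k * d i); first split.
- by rewrite -mulr_sumr d0 mulr0.
- under eq_bigr do rewrite nsqM nk mulrCA.
  by rewrite -mulr_sumr mulVf// gt_eqF.
- rewrite /moment mulr_sumr; apply: eq_bigr => i _.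
  by rewrite nsqM nk mulrCA rmorphM/= mulrA.
Qed.

(* Toeplitz-Hausdorff: om is a phase for which the cross terms between om d and
   e are real in the affine coordinate sending x to 0 and y to 1, so that the
   image of the path c stays on the line through x and y. *)
Lemma node_range_convex (x y : C) (t : R) : 0 <= t <= 1 ->
  node_range z G x -> node_range z G y ->
  node_range z G ((1 - t)%:C * x + t%:C * y).
Proof.
move=> /andP[t0 t1] Kx Ky.
have [xy|xy] := eqVneq x y.
  by rewrite -xy -mulrDl -rmorphD/= subrK mul1r.
case: Kx Ky => d [d0 d1] dx [e [e0 e1] ey].
have xy0 : y - x != 0 by rewrite subr_eq0 eq_sym.
pose u i := (z i - x) / (y - x).
pose F c := \sum_i (G i)%:C * (conjc (c i) * c i) * u i.
have FE c : F c = (moment c - (mass c)%:C * x) / (y - x).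
  rewrite /moment /mass rmorph_sum/= mulr_suml -sumrB mulr_suml.
  apply: eq_bigr => i _; rewrite -nsqE /u rmorphM/=.
  by rewrite -mulrBr -!mulrA.
have Fd : F d = 0 by rewrite FE /mass d1 /moment dx mul1r subrr mul0r.
have Fe : F e = 1 by rewrite FE /mass e1 /moment ey mul1r divff.
pose S1 := \sum_i (G i)%:C * (d i * conjc (e i)) * u i.
pose S2 := \sum_i (G i)%:C * (conjc (d i) * e i) * u i.
have [om [om1 omS]] : exists om : C, nsq om = 1 /\
    complex.Im (om * S1 + conjc om * S2) = 0.
  (* The imaginary part in question is that of [om * S], so the phase of [conjc S] makes it
     vanish. *)
  pose S := S1 - conjc S2.
  have im om : complex.Im (om * S1 + conjc om * S2) = complex.Im (om * S).
    by rewrite /S; case: om => a b; case: (S1) (S2) => p q [r s] /=; ring.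
  have [S0|S0] := eqVneq S 0.
    by exists 1; rewrite im S0 mulr0 /nsq/= expr1n expr0n addr0.
  have nS := nsq_gt0 S0.
  exists ((Num.sqrt (nsq S)^-1)%:C * conjc S); split.
    rewrite nsqM {1}/nsq /= expr0n addr0 sqr_sqrtr ?invr_ge0 ?ltW//.
    have -> : nsq (conjc S) = nsq S by case: (S) => a b; rewrite /nsq/= sqrrN.
    by rewrite mulVf// gt_eqF.
  by rewrite im -mulrA -nsqE -rmorphM.
pose beta := complex.Re (om * S1 + conjc om * S2).
have betaE : om * S1 + conjc om * S2 = beta%:C.
  by rewrite [LHS]complexE omS mulr0 addr0.
pose g0 := \sum_i (G i)%:C * (d i * conjc (e i)).
pose gam := 2 * complex.Re (om * g0).
have gamE : om * g0 + conjc om * conjc g0 = gam%:C.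
  rewrite /gam; case: (om) (g0) => a b [p q].
  by apply/eqP; rewrite eq_complex/=; apply/andP; split; apply/eqP; ring.
pose c r i : C := (1 - r)%:C * om * d i + r%:C * e i.
have om1C : conjc om * om = 1 by rewrite -nsqE om1.
have cc r i : conjc (c r i) * c r i =
   ((1 - r) ^+ 2)%:C * (conjc (d i) * d i) + (r ^+ 2)%:C * (conjc (e i) * e i) +
   (r * (1 - r))%:C * (om * (d i * conjc (e i)) + conjc om * (conjc (d i) * e i)).
  transitivity (((1 - r) ^+ 2)%:C * (conjc om * om) * (conjc (d i) * d i) +
   (r ^+ 2)%:C * (conjc (e i) * e i) + (r * (1 - r))%:C *
   (om * (d i * conjc (e i)) + conjc om * (conjc (d i) * e i))).
    rewrite /c; case: (om) (d i) (e i) => a b [p q] [s t'].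
    by apply/eqP; rewrite eq_complex/=; apply/andP; split; apply/eqP; ring.
  by rewrite om1C mulr1.
have Fc r : F (c r) = (r ^+ 2 + r * (1 - r) * beta)%:C.
  transitivity (((1 - r) ^+ 2)%:C * F d + (r ^+ 2)%:C * F e +
     (r * (1 - r))%:C * (om * S1 + conjc om * S2)).
    rewrite /F /S1 /S2 !mulr_sumr -!big_split/= !mulr_sumr -big_split/=.
    by apply: eq_bigr => i _; rewrite cc; ring.
  by rewrite Fd Fe betaE mulr0 mulr1 add0r -rmorphM -rmorphD.
have massC c' : (mass c')%:C = \sum_i (G i)%:C * (conjc (c' i) * c' i).
  by rewrite /mass rmorph_sum/=; apply: eq_bigr => i _; rewrite rmorphM/= nsqE.
have mc r : mass (c r) = (1 - r) ^+ 2 + r ^+ 2 + r * (1 - r) * gam.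
  apply: complexI; rewrite massC.
  transitivity (((1 - r) ^+ 2)%:C * (mass d)%:C + (r ^+ 2)%:C * (mass e)%:C +
     (r * (1 - r))%:C * (om * g0 + conjc om * conjc g0)).
    rewrite !massC /g0 rmorph_sum/= !mulr_sumr -!big_split/= !mulr_sumr -big_split/=.
    apply: eq_bigr => i _; rewrite cc !rmorphM/= conjcK oppr0.
    by rewrite -/((G i)%:C); ring.
  by rewrite /mass d1 e1 gamE !mulr1 -rmorphM -!rmorphD.
(* If [c r] vanished, r e would equal - (1 - r) om d; comparing the values of [F] would force r = 0,
   and comparing masses then r = 1. *)
have mc0 r : 0 < mass (c r).
  rewrite lt_neqAle mass_ge0 andbT eq_sym; apply/eqP => m0.
  have c0 i : c r i = 0 by exact: mass_eq0.
  have ed i : (r ^+ 2)%:C * (conjc (e i) * e i) =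
              ((1 - r) ^+ 2)%:C * (conjc (d i) * d i).
    have h : r%:C * e i = - ((1 - r)%:C * om * d i).
      by apply/eqP; rewrite -addr_eq0 addrC; apply/eqP; exact: c0.
    transitivity (conjc (r%:C * e i) * (r%:C * e i)).
      case: (e i) => p q.
      by apply/eqP; rewrite eq_complex/=; apply/andP; split; apply/eqP; ring.
    rewrite h -[RHS]mulr1 -om1C; case: (om) (d i) => a b [p q].
    by apply/eqP; rewrite eq_complex/=; apply/andP; split; apply/eqP; ring.
  have eF : (r ^+ 2)%:C * F e = ((1 - r) ^+ 2)%:C * F d.
    rewrite /F !mulr_sumr; apply: eq_bigr => i _.
    have -> a b : a * ((G i)%:C * b * u i) = (a * b) * ((G i)%:C * u i).
      by ring.
    by rewrite ed; ring.
  have em : (r ^+ 2)%:C * (mass e)%:C = ((1 - r) ^+ 2)%:C * (mass d)%:C.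
    by rewrite !massC !mulr_sumr; apply: eq_bigr => i _; rewrite mulrCA ed mulrCA.
  move: eF; rewrite Fe Fd mulr1 mulr0 => /complexI r0.
  move: em; rewrite /mass e1 d1 !mulr1 r0 => /complexI h.
  by move: r0 h; nra.
(* This is [F (c r)] minus t times the mass of [c r]. It goes from - t at 0 to 1 - t at 1, and a
   root gives the point of parameter t. *)
pose P : {poly R} := (1 - beta - 2 * t + t * gam) *: 'X^2
   + (beta + 2 * t - t * gam) *: 'X + (- t)%:P.
have PE r : P.[r] = r ^+ 2 + r * (1 - r) * beta - t * mass (c r).
  by rewrite mc /P !hornerE/=; ring.
have [|r _ Pr] := @poly_ivt R P 0 1 ler01.
  rewrite !PE !mc expr0n expr1n /= !mul0r !subr0 !addr0 subrr.
  rewrite !mulr0 !mul0r !addr0 expr0n/=.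
  by rewrite expr1n; apply/andP; split; lra.
have {Pr}hr : r ^+ 2 + r * (1 - r) * beta = t * mass (c r).
  by apply/eqP; rewrite -subr_eq0 -PE.
have cs : \sum_i c r i = 0.
  by rewrite big_split/= -!mulr_sumr d0 e0 !mulr0 addr0.
suff -> : (1 - t)%:C * x + t%:C * y = (mass (c r))^-1%:C * moment (c r).
  exact: node_range_cone.
have mn : (mass (c r))%:C != 0 :> C.
  by rewrite (inj_eq (@complexI R)) gt_eqF.
have : moment (c r) = (mass (c r))%:C * x + (mass (c r) * t)%:C * (y - x).
  have := Fc r; rewrite hr FE => /(congr1 (fun w => w * (y - x))).
  rewrite divfK// mulrC => /eqP; rewrite subr_eq addrC => /eqP ->.
  by rewrite [t * _]mulrC [_ * (y - x)]mulrC.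
move=> ->; rewrite fmorphV/= rmorphM/= rmorphB/= rmorph1.
by field.
Qed.

End ToeplitzHausdorff.

(** * Polygons inscribed in the unit circle *)

Section Polygons.
Variables (R : realType) (n : nat).
Local Notation C := R[i].
Implicit Types (z : 'I_n.+1 -> C) (G t : 'I_n.+1 -> R).

Lemma Re_sum (I : finType) (f : I -> C) :
  complex.Re (\sum_i f i) = \sum_i complex.Re (f i).
Proof. by apply: (big_morph (@complex.Re R)) => // -[a b] [c d]. Qed.

Lemma Im_sum (I : finType) (f : I -> C) :
  complex.Im (\sum_i f i) = \sum_i complex.Im (f i).
Proof. by apply: (big_morph (@complex.Im R)) => // -[a b] [c d]. Qed.

Lemma ReZ (r : R) (x : C) : complex.Re (r%:C * x) = r * complex.Re x.
Proof. by case: x => a b /=; rewrite mul0r subr0. Qed.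

Lemma ImZ (r : R) (x : C) : complex.Im (r%:C * x) = r * complex.Im x.
Proof. by case: x => a b /=; rewrite mul0r addr0. Qed.

Lemma complex_eqP (x y : C) :
  complex.Re x = complex.Re y -> complex.Im x = complex.Im y -> x = y.
Proof. by case: x y => a b [c d] /= -> ->. Qed.

Lemma segment_left (a b : C) : segment a b a.
Proof.
exists 0; first by rewrite /= in_itv/= lexx ler01.
by rewrite subr0 rmorph1 rmorph0 mul1r mul0r addr0.
Qed.

Lemma segment_right (a b : C) : segment a b b.
Proof.
exists 1; first by rewrite /= in_itv/= lexx ler01.
by rewrite subrr rmorph1 rmorph0 mul1r mul0r add0r.
Qed.

Lemma node_range_hull z G : (forall i, 0 < G i) -> node_range z G `<=` hull z.
Proof.
move=> G0 _ [d [_ d1] <-]; exists (fun i => G i * nsq (d i)) => //.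
by split=> // i; rewrite mulr_ge0 ?nsq_ge0// ltW.
Qed.

Lemma hull_node z i : hull z (z i).
Proof.
exists (fun j => (j == i)%:R); first split; first by move=> j; exact: ler0n.
  by rewrite (bigD1 i)//= eqxx big1 ?addr0// => j /negbTE ->.
rewrite (bigD1 i)//= eqxx rmorph1 mul1r big1 ?addr0// => j /negbTE ->.
by rewrite rmorph0 mul0r.
Qed.

(** Coordinates 1 at i, -1 at j and 0 elsewhere put a point of the range on every chord. *)
Lemma node_range_pair z G i j : (forall k, 0 < G k) -> i != j ->
  node_range z G ((G i / (G i + G j))%:C * z i + (G j / (G i + G j))%:C * z j).
Proof.
move=> G0 ij; have ji : j == i = false by rewrite eq_sym (negbTE ij).
pose d k : C := (k == i)%:R - (k == j)%:R.
have di : d i = 1 by rewrite /d eqxx (negbTE ij) subr0.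
have dj : d j = -1 by rewrite /d eqxx ji sub0r.
have dk k : k != i -> k != j -> d k = 0.
  by rewrite /d => /negbTE -> /negbTE ->; rewrite subrr.
have nsq0 : nsq (0 : C) = 0 by rewrite /nsq/= expr0n addr0.
have nsq1 : nsq (1 : C) = 1 by rewrite /nsq/= expr0n addr0 expr1n.
have nsqN1 : nsq (-1 : C) = 1 by rewrite /nsq/= oppr0 expr0n addr0 sqrrN expr1n.
have me : mass G d = G i + G j.
  rewrite /mass (bigD1 i)//= (bigD1 j)/=; last by rewrite ji.
  rewrite di dj nsq1 nsqN1 !mulr1 big1 ?addr0// => k /andP[ki kj].
  by rewrite dk// nsq0 mulr0.
have mp : 0 < mass G d by rewrite me addr_gt0.
have ds : \sum_k d k = 0.
  rewrite (bigD1 i)//= (bigD1 j)/=; last by rewrite ji.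
  rewrite di dj [X in _ + (_ + X)]big1; last first.
    by move=> k /andP[ki kj]; rewrite dk.
  by rewrite addr0 subrr.
have := node_range_cone z ds mp.
rewrite me /moment (bigD1 i)//= (bigD1 j)/=; last by rewrite ji.
rewrite di dj nsq1 nsqN1 !mulr1 [X in _ + (_ + X)]big1; last first.
  by move=> k /andP[ki kj]; rewrite dk// nsq0 mulr0 mul0r.
by rewrite addr0 mulrDr !mulrA -!rmorphM/= ![(_)^-1 * _]mulrC.
Qed.

(** The hull lies in the closed unit disk, where points of the circle are extreme because |(1-t)a +
    tb|^2 = (1-t)|a|^2 + t|b|^2 - t(1-t)|a-b|^2. *)
Lemma unit_circle_polygon z : injective z -> (forall i, `|z i| = 1) ->
  solid_polygon n.+1 (hull z).
Proof.
move=> zi z1; exists z; split=> // i; split; first exact: hull_node.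
have n1 k : nsq (z k) = 1.
  by apply: complexI; rewrite nsqE mulrC circle_mul_conj.
have disk a : hull z a -> nsq a <= 1.
  move=> [t [t0 t1] <-].
  set a' := (X in nsq X); pose x := complex.Re a'; pose y := complex.Im a'.
  have xE : x = \sum_k t k * complex.Re (z k).
    by rewrite /x Re_sum; apply: eq_bigr => k _; rewrite ReZ.
  have yE : y = \sum_k t k * complex.Im (z k).
    by rewrite /y Im_sum; apply: eq_bigr => k _; rewrite ImZ.
  have sq : x ^+ 2 + y ^+ 2 <= \sum_k t k * ((x ^+ 2 + y ^+ 2 + 1) / 2).
    rewrite [leLHS](_ : _ =
        \sum_k t k * (x * complex.Re (z k) + y * complex.Im (z k))); last first.
      rewrite expr2 [y ^+ 2]expr2 {2}xE {2}yE !mulr_sumr -big_split/=.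
      by apply: eq_bigr => k _; ring.
    apply: ler_sum => k _; apply: ler_wpM2l => //.
    have gen (p q r s : R) : r ^+ 2 + s ^+ 2 = 1 ->
        p * r + q * s <= (p ^+ 2 + q ^+ 2 + 1) / 2.
      by have := sqr_ge0 (p - r); have := sqr_ge0 (q - s); nra.
    exact/gen/n1.
  have -> : nsq a' = x ^+ 2 + y ^+ 2 by [].
  by move: sq; rewrite -mulr_suml t1 mul1r; generalize (x ^+ 2 + y ^+ 2) => s; lra.
move=> a b t /disk da /disk db /andP[t0 t1] e.
have := n1 i; rewrite e /nsq; move: da db {e}; rewrite /nsq.
case: a b => a1 a2 [b1 b2] /= da db.
rewrite !mul0r !subr0 !addr0 => h.
have : (1 - t) * t * ((a1 - b1) ^+ 2 + (a2 - b2) ^+ 2) <= 0 by nra.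
have tt : 0 < (1 - t) * t by rewrite mulr_gt0// subr_gt0.
rewrite pmulr_rle0// => h2.
have h3 : (a1 - b1) ^+ 2 + (a2 - b2) ^+ 2 == 0.
  by rewrite eq_le h2 addr_ge0 ?sqr_ge0.
move: h3; rewrite paddr_eq0 ?sqr_ge0// !sqrf_eq0 !subr_eq0.
by move=> /andP[/eqP -> /eqP ->].
Qed.

(** A face with two distinct points contains two nodes, and the range meets the chord between them;
    it stays on one side because it lies in the hull. *)
Lemma side_tangent z G a b : (forall i, 0 < G i) ->
  side (hull z) a b -> tangent_segment a b (node_range z G).
Proof.
move=> G0 [ab [u [c [u0 uc ue]]]].
pose g (x : C) := complex.Re (conjc u * x).
have gE x : complex.Re (u^* * x)%R = g x by [].
have gsum (t : 'I_n.+1 -> R) : g (\sum_i (t i)%:C * z i) = \sum_i t i * g (z i).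
  rewrite /g mulr_sumr Re_sum; apply: eq_bigr => i _.
  by rewrite mulrCA ReZ.
have seg x : segment a b x <-> hull z x /\ g x = c by rewrite -ue.
have [ha ga] := (seg a).1 (segment_left a b).
have [hb gb] := (seg b).1 (segment_right a b).
have gz i : g (z i) <= c by apply: uc; exact: hull_node.
have supp (t : 'I_n.+1 -> R) : (forall i, 0 <= t i) -> \sum_i t i = 1 ->
    g (\sum_i (t i)%:C * z i) = c -> forall i, g (z i) <> c -> t i = 0.
  move=> t0 t1 gt i gi; have : \sum_k t k * (c - g (z k)) = 0.
    under eq_bigr do rewrite mulrBr.
    by rewrite sumrB -mulr_suml t1 mul1r -gsum gt subrr.
  move=> /eqP; rewrite psumr_eq0 => [/allP/(_ i (mem_index_enum _))/=|k _]; last first.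
    by rewrite mulr_ge0// subr_ge0.
  by rewrite mulf_eq0 => /orP[/eqP//|]; rewrite subr_eq0 => /eqP/esym.
split; last first.
  have gK x : node_range z G x -> g x <= c.
    by move=> /(node_range_hull G0); exact: uc.
  case: u a b {ab uc ue gsum ha hb gz supp seg} @g gE ga gb gK u0
    => s t [a1 a2] [b1 b2] /= gE ga gb gK u0.
  have st : 0 < s ^+ 2 + t ^+ 2.
    rewrite lt_neqAle addr_ge0 ?sqr_ge0// andbT eq_sym paddr_eq0 ?sqr_ge0//.
    by rewrite !sqrf_eq0; apply/negP => /andP[/eqP s0 /eqP t0]; apply: u0; rewrite s0 t0.
  (* Since b - a is orthogonal to u = (s, t), the signed distance is a constant multiple of [c - g],
     and the sign of [k] decides the side. *)
  pose k := s * (b2 - a2) - t * (b1 - a1).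
  have key x y : (s ^+ 2 + t ^+ 2) *
      ((b1 - a1) * (y - a2) + - (b2 - a2) * (x - a1)) = k * (c - (s * x + t * y)).
    rewrite /k; have h : s * (b1 - a1) + t * (b2 - a2) = 0 by lra.
    have -> : c = s * a1 + t * a2 by lra.
    transitivity ((s ^+ 2 + t ^+ 2) *
      ((b1 - a1) * (y - a2) + - (b2 - a2) * (x - a1))
      - (s * (b1 - a1) + t * (b2 - a2)) * (s * (y - a2) - t * (x - a1))).
      by rewrite h; ring.
    by ring.
  have [k0|k0] := lerP 0 k; [left|right] => -[x y] /gK /=; rewrite /= => h.
    rewrite -(pmulr_rge0 _ st) key mulr_ge0// subr_ge0.
    by move: h; lra.
  rewrite -(pmulr_rle0 _ st) key mulr_le0_ge0 ?(ltW k0)// subr_ge0.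
  by move: h; lra.
have [[i [j [ij gi gj]]]|nij] :=
    pselect (exists i j, [/\ i != j, g (z i) = c & g (z j) = c]).
  exists ((G i / (G i + G j))%:C * z i + (G j / (G i + G j))%:C * z j).
  have h : node_range z G ((G i / (G i + G j))%:C * z i + (G j / (G i + G j))%:C * z j).
    exact: node_range_pair.
  split=> //; apply/seg; split; first exact: node_range_hull h.
  have Gs : G i + G j != 0 by rewrite gt_eqF// addr_gt0.
  have gD x y : g (x + y) = g x + g y.
    by rewrite /g mulrDr; case: (_ * x) => ? ?; case: (_ * y).
  have gZ r x : g (r%:C * x) = r * g x by rewrite /g mulrCA ReZ.
  by rewrite gD !gZ gi gj; field.
(* With at most one node on the supporting line, the face is at most that node. *)
exfalso; apply: ab.
have [i gi] : exists i, g (z i) = c.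
  apply: contrapT => /forallNP ni; case: ha => t [t0 t1] ea.
  have tz i : t i = 0 by apply: (supp t) => //; rewrite ea.
  by move: t1; rewrite big1 => [|i _]; rewrite ?tz// => /eqP; rewrite eq_sym oner_eq0.
have only x : hull z x -> g x = c -> x = z i.
  move=> [t [t0 t1] <-] gx.
  have tz k : k != i -> t k = 0.
    move=> ki; apply: (supp t) => // gk; apply: nij.
    by exists k, i.
  have ti : t i = 1.
    by rewrite -t1 (bigD1 i)//= big1 ?addr0.
  rewrite (bigD1 i)//= ti rmorph1 mul1r big1 ?addr0// => k ki.
  by rewrite tz// rmorph0 mul0r.
by rewrite (only a)// (only b).
Qed.

End Polygons.

(** * The envelope of the sides *)

Section PlaneTopology.
Variable R : realType.
Local Notation C := R[i].

Lemma nsq_lt (x : C) (e : R) : 0 < e -> (`|x| < e%:C) = (nsq x < e ^+ 2).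
Proof.
move=> e0; have e0' : 0 <= e%:C :> C by rewrite lecR ltW.
by rewrite -ltcR /nsq add_Re2_Im2 rmorphXn/= ltr_pXn2r ?nnegrE ?normr_ge0.
Qed.

Lemma Re_nsq (x : C) : complex.Re x ^+ 2 <= nsq x.
Proof. by rewrite lerDl sqr_ge0. Qed.

Lemma Im_nsq (x : C) : complex.Im x ^+ 2 <= nsq x.
Proof. by rewrite lerDr sqr_ge0. Qed.

Lemma interior_nsq (S : set C) (x : C) :
  interior (S : set C^o) x <->
  exists2 e : R, 0 < e & forall y, nsq (y - x) < e ^+ 2 -> S y.
Proof.
split=> [/nbhs_ballP[e /= e0 eS]|[e e0 eS]].
  have eR : e = (complex.Re e)%:C.
    by case: e e0 {eS} => a b; rewrite ltcE /= => /andP[/eqP -> _].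
  have e0' : 0 < complex.Re e by move: e0; rewrite eR ltcR.
  exists (complex.Re e) => // y ye; apply: eS.
  by rewrite -ball_normE /= distrC eR nsq_lt.
apply/nbhs_ballP; exists e%:C; first by rewrite /= ltcR.
by move=> y; rewrite -ball_normE /= distrC nsq_lt// => /eS.
Qed.

Lemma closure_nsq (S : set C) (x : C) :
  closure (S : set C^o) x -> forall e : R, 0 < e ->
  exists2 y, S y & nsq (y - x) < e ^+ 2.
Proof.
move=> Sx e e0; have [|y [Sy ye]] := Sx (ball (x : C^o) e%:C).
  by apply: nbhsx_ballx; rewrite ltcR.
exists y => //; move: ye; rewrite -ball_normE /= distrC.
by rewrite nsq_lt.
Qed.

End PlaneTopology.

(** * Lines through consecutive zeros and their contact points *)

Section Envelope.
Variables (R : realType) (n : nat) (v tau : R -> R) (K : set R[i]).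
Hypothesis n_gt0 : (0 < n)%N.
Hypothesis v_gt0 : forall t, 0 < v t.
Hypothesis dtau : forall t : R, is_derive t 1 tau (v (tau t)).
Hypothesis tauD2pi : forall t, tau (t + 2 * pi) = tau t + 2 * pi.
Hypothesis K_coords : forall t, exists G : 'I_n.+1 -> R,
  (forall i, 0 < G i) /\ K = node_range (popuc_zero tau t) G.
Local Notation C := R[i].
Implicit Types (t s : R) (x : C).

Definition step : R := 2 * pi / n.+1%:R.
Definition tau' t : R := tau (t + step).
Definition mid t : R := (tau t + tau' t) / 2.
Definition half t : R := (tau' t - tau t) / 2.
Definition dmid t : R := (v (tau t) + v (tau' t)) / 2.
Definition dhalf t : R := (v (tau' t) - v (tau t)) / 2.

(* The line gap t = 0 carries the side joining cis (tau t) to the next zero. *)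
Definition gap t x : R :=
  cos (half t) - (complex.Re x * cos (mid t) + complex.Im x * sin (mid t)).

Definition dgap t x : R :=
  - dhalf t * sin (half t)
  + dmid t * (complex.Re x * sin (mid t) - complex.Im x * cos (mid t)).

(** The limit of intersections of the chord with neighbouring chords: it divides the chord in the
    ratio of the speeds [v] of its ends, hence the crossed weights. *)
Definition curve_re t : R :=
  (v (tau' t) * cos (tau t) + v (tau t) * cos (tau' t)) / (v (tau t) + v (tau' t)).
Definition curve_im t : R :=
  (v (tau' t) * sin (tau t) + v (tau t) * sin (tau' t)) / (v (tau t) + v (tau' t)).
Definition curve t : C := curve_re t +i* curve_im t.

Lemma step_gt0 : 0 < step.
Proof. by rewrite divr_gt0// ?ltr0n// mulr_gt0// pi_gt0. Qed.

Lemma stepE : n.+1%:R * step = 2 * pi.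
Proof. by rewrite mulrC divfK// pnatr_eq0. Qed.

Lemma tau_lt s t : s < t -> tau s < tau t.
Proof.
move=> st; have [c [_ _ e]] := mean_value s t dtau.
by rewrite -subr_gt0 e mulr_gt0// subr_gt0.
Qed.

Lemma tau_le s t : s <= t -> tau s <= tau t.
Proof. by rewrite le_eqVlt => /predU1P[->//|/tau_lt/ltW]. Qed.

Lemma step_lt2pi : step < 2 * pi.
Proof.
rewrite -stepE ltr_pMl ?step_gt0//.
by rewrite ltr1n.
Qed.

Lemma tau'_bounds t : tau t < tau' t < tau t + 2 * pi.
Proof.
rewrite -tauD2pi /tau'; apply/andP; split; apply: tau_lt.
  by rewrite ltrDl step_gt0.
by rewrite ltrD2l step_lt2pi.
Qed.

Lemma half_bounds t : 0 < half t < pi.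
Proof. by rewrite /half; have /andP[h1 h2] := tau'_bounds t; apply/andP; split; lra. Qed.

Lemma midBhalf t : mid t - half t = tau t.
Proof. by rewrite /mid /half; lra. Qed.

Lemma midDhalf t : mid t + half t = tau' t.
Proof. by rewrite /mid /half; lra. Qed.

Lemma tau'D2pi t : tau' (t + 2 * pi) = tau' t + 2 * pi.
Proof. by rewrite /tau' addrAC tauD2pi. Qed.

Lemma midD2pi t : mid (t + 2 * pi) = mid t + 2 * pi.
Proof. by rewrite /mid tauD2pi tau'D2pi; lra. Qed.

Lemma halfD2pi t : half (t + 2 * pi) = half t.
Proof. by rewrite /half tauD2pi tau'D2pi; lra. Qed.

Lemma gapD2pi t x : gap (t + 2 * pi) x = gap t x.
Proof.
have e : 2 * pi = pi *+ 2 :> R by rewrite mulr_natl.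
by rewrite /gap midD2pi halfD2pi e cosD2pi sinD2pi.
Qed.

Lemma gap_cis t a : gap t (cis a) = cos (half t) - cos (a - mid t).
Proof. by rewrite /gap /cis /= cosB. Qed.

Lemma gap_tau t : gap t (cis (tau t)) = 0.
Proof.
rewrite gap_cis; have -> : tau t - mid t = - half t by rewrite -(midBhalf t); lra.
by rewrite cosN subrr.
Qed.

Lemma gap_tau' t : gap t (cis (tau' t)) = 0.
Proof.
rewrite gap_cis; have -> : tau' t - mid t = half t by rewrite -(midDhalf t); lra.
by rewrite subrr.
Qed.

Lemma cos_lt_far (d a : R) : 0 < d < pi -> d < a < 2 * pi - d -> cos a < cos d.
Proof.
move=> /andP[d0 dp] /andP[da ad].
have [ap|pa] := leP a pi.
  by rewrite ltr_cos// in_itv/=; apply/andP; split; lra.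
rewrite -[cos a]cosN -[cos (- a)]cosD2pi mulr2n.
by rewrite ltr_cos ?in_itv/=; first lra; apply/andP; split; lra.
Qed.

Lemma gap_cis_gt0 t a : tau' t < a < tau t + 2 * pi -> 0 < gap t (cis a).
Proof.
move=> /andP[h1 h2]; rewrite gap_cis subr_gt0; apply: cos_lt_far.
  exact: half_bounds.
by have e1 := midBhalf t; have e2 := midDhalf t; apply/andP; split; lra.
Qed.

Lemma popuc_zeroE t (i : 'I_n.+1) : popuc_zero tau t i = cis (tau (t + i%:R * step)).
Proof. by []. Qed.

Lemma gap_zero_gt0 t (i : 'I_n.+1) : (1 < i)%N -> 0 < gap t (popuc_zero tau t i).
Proof.
move=> i1; rewrite popuc_zeroE; apply: gap_cis_gt0; rewrite -tauD2pi -stepE.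
have s0 := step_gt0.
apply/andP; split; apply: tau_lt; rewrite ltrD2l.
  by rewrite ltr_pMl// ltr1n.
by rewrite ltr_pM2r// ltr_nat.
Qed.

Lemma gap_zero_ge0 t (i : 'I_n.+1) : 0 <= gap t (popuc_zero tau t i).
Proof.
case: (ltngtP i 1%N) => [i0|/gap_zero_gt0/ltW//|i1].
  have -> : popuc_zero tau t i = cis (tau t).
    rewrite popuc_zeroE; have -> : nat_of_ord i = 0%N by case: (nat_of_ord i) i0.
    by rewrite mul0r addr0.
  by rewrite gap_tau.
by rewrite popuc_zeroE i1 mul1r -/(tau' t) gap_tau'.
Qed.

Lemma gap_hull t x : hull (@popuc_zero R n tau t) x -> 0 <= gap t x.
Proof.
move=> [p [p0 p1] <-]; set z := @popuc_zero R n tau t.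
have -> : gap t (\sum_i (p i)%:C * z i) = \sum_i p i * gap t (z i).
  rewrite /gap Re_sum Im_sum -[in LHS](mul1r (cos (half t))) -p1.
  rewrite !mulr_suml -big_split/= -sumrB; apply: eq_bigr => i _.
  by rewrite /z /gap /popuc_zero /cis /=; ring.
by apply: sumr_ge0 => i _; rewrite mulr_ge0// gap_zero_ge0.
Qed.

Lemma gap_convex t (p q : R) x y : p + q = 1 ->
  gap t (p%:C * x + q%:C * y) = p * gap t x + q * gap t y.
Proof.
move=> pq; have -> : q = 1 - p by lra.
by rewrite /gap; case: x y => a b [c d] /=; ring.
Qed.

Lemma K_hull t : K `<=` hull (@popuc_zero R n tau t).
Proof. by have [G [G0 ->]] := K_coords t; exact: node_range_hull. Qed.

Lemma K_gap x t : K x -> 0 <= gap t x.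
Proof. by move=> /(K_hull t)/gap_hull. Qed.

Lemma is_derive_tau' t : is_derive t 1 tau' (v (tau' t)).
Proof.
have h := is_derive_addf (is_derive_id t (1 : R)) (is_derive_constf step t).
by apply: (is_derive_eq (is_derive_compf h (dtau (t + step)))); rewrite addr0 mul1r.
Qed.

Lemma is_derive_mid t : is_derive t 1 mid (dmid t).
Proof.
have h := is_derive_mulf (is_derive_addf (dtau t) (is_derive_tau' t))
  (is_derive_constf (2^-1) t).
by apply: (is_derive_eq h); rewrite mulr0 addr0.
Qed.

Lemma is_derive_half t : is_derive t 1 half (dhalf t).
Proof.
have h := is_derive_mulf (is_derive_subf (is_derive_tau' t) (dtau t))
  (is_derive_constf (2^-1) t).
by apply: (is_derive_eq h); rewrite mulr0 addr0.
Qed.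

Lemma is_derive_gap t x : is_derive t 1 (gap^~ x) (dgap t x).
Proof.
have hh := is_derive_compf (is_derive_half t) (is_derive_cos (half t)).
have hc := is_derive_compf (is_derive_mid t) (is_derive_cos (mid t)).
have hs := is_derive_compf (is_derive_mid t) (is_derive_sin (mid t)).
have h := is_derive_subf hh (is_derive_addf
  (is_derive_mulf (is_derive_constf (complex.Re x) t) hc)
  (is_derive_mulf (is_derive_constf (complex.Im x) t) hs)).
by apply: (is_derive_eq h); rewrite /dgap; ring.
Qed.

Lemma dmid_gt0 t : 0 < dmid t.
Proof. by rewrite divr_gt0// addr_gt0. Qed.

Lemma v_sum_neq0 t : v (tau t) + v (tau' t) != 0.
Proof. by rewrite gt_eqF// addr_gt0. Qed.

Lemma curve_convex t :
  curve t = (v (tau' t) / (v (tau t) + v (tau' t)))%:C * cis (tau t) +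
            (v (tau t) / (v (tau t) + v (tau' t)))%:C * cis (tau' t).
Proof.
have h := v_sum_neq0 t; rewrite /curve /curve_re /curve_im /cis.
by apply/eqP; rewrite eq_complex/=; apply/andP; split; apply/eqP; field.
Qed.

Lemma gap_curve t : gap t (curve t) = 0.
Proof.
rewrite curve_convex gap_convex ?gap_tau ?gap_tau' ?mulr0 ?addr0//.
by have h := v_sum_neq0 t; field.
Qed.

Lemma dgap_curve t : dgap t (curve t) = 0.
Proof.
have s1 : cos (tau t) * sin (mid t) - sin (tau t) * cos (mid t) = sin (half t).
  by rewrite mulrC [sin (tau t) * _]mulrC -sinB; congr sin; rewrite -(midBhalf t); lra.
have s2 : cos (tau' t) * sin (mid t) - sin (tau' t) * cos (mid t) = - sin (half t).
  rewrite mulrC [sin (tau' t) * _]mulrC -sinB -sinN; congr sin.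
  by rewrite -(midDhalf t); lra.
have h := v_sum_neq0 t; rewrite /dgap /curve /=.
have -> : curve_re t * sin (mid t) - curve_im t * cos (mid t) =
   sin (half t) * (v (tau' t) - v (tau t)) / (v (tau t) + v (tau' t)).
  have -> : curve_re t * sin (mid t) - curve_im t * cos (mid t) =
     (v (tau' t) * (cos (tau t) * sin (mid t) - sin (tau t) * cos (mid t)) +
      v (tau t) * (cos (tau' t) * sin (mid t) - sin (tau' t) * cos (mid t)))
     / (v (tau t) + v (tau' t)).
    by rewrite /curve_re /curve_im; field.
  by rewrite s1 s2; field.
by rewrite /dhalf /dmid; field.
Qed.

(* s |-> gap s x has a minimum at t, so gap t x = dgap t x = 0, and these are two
   independent linear equations for x, which curve t satisfies. *)
Lemma gap_contact t x : (forall s, 0 <= gap s x) -> gap t x = 0 -> x = curve t.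
Proof.
move=> xI xt; have dx0 : dgap t x = 0.
  have hm : is_derive t 1 (gap^~ x) 0.
    apply: (@derive1_at_min _ _ (t - 1) (t + 1)).
    - lra.
    - by move=> s _; apply: ex_derive; exact: is_derive_gap.
    - by rewrite in_itv/=; apply/andP; split; lra.
    - by move=> s _; rewrite xt.
  have h := is_derive_gap t x.
  by rewrite -(@derive_val _ _ _ _ _ _ _ h) (@derive_val _ _ _ _ _ _ _ hm).
have c0 := gap_curve t; have dc0 := dgap_curve t.
have m0 := dmid_gt0 t; have cs := cos2Dsin2 (mid t).
pose p := complex.Re x - curve_re t; pose q := complex.Im x - curve_im t.
have e1 : p * cos (mid t) + q * sin (mid t) = 0.
  by move: xt c0; rewrite /gap /p /q /=; lra.
have e2 : p * sin (mid t) - q * cos (mid t) = 0.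
  apply/eqP; rewrite -(mulrI_eq0 _ (lregP (lt0r_neq0 m0))); apply/eqP.
  transitivity (dgap t x - dgap t (curve t)); last by rewrite dx0 dc0 subrr.
  by rewrite /dgap /p /q /=; ring.
have p0 : p = 0.
  rewrite -[LHS]mulr1 -cs.
  transitivity (cos (mid t) * (p * cos (mid t) + q * sin (mid t)) +
                sin (mid t) * (p * sin (mid t) - q * cos (mid t))); first by ring.
  by rewrite e1 e2 !mulr0 addr0.
have q0 : q = 0.
  rewrite -[LHS]mulr1 -cs.
  transitivity (sin (mid t) * (p * cos (mid t) + q * sin (mid t)) -
                cos (mid t) * (p * sin (mid t) - q * cos (mid t))); first by ring.
  by rewrite e1 e2 !mulr0 subr0.
by apply: complex_eqP; apply/eqP; rewrite -subr_eq0; [rewrite -/p p0|rewrite -/q q0].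
Qed.

(** The first two zeros give a point of [K] on the line, at a position depending on unknown weights;
    [gap_contact] identifies it. *)
Lemma K_curve t : K (curve t).
Proof.
have [G [G0 KE]] := K_coords t.
pose i0 : 'I_n.+1 := ord0; pose i1 : 'I_n.+1 := Ordinal (n_gt0 : (1 < n.+1)%N).
have := @node_range_pair _ _ (@popuc_zero R n tau t) G i0 i1 G0 isT.
rewrite -KE; set x := (X in K X) => Kx.
rewrite -(@gap_contact t x)//; first by move=> s; exact: K_gap.
rewrite /x gap_convex; last first.
  by rewrite -mulrDl divff// gt_eqF// addr_gt0.
rewrite !popuc_zeroE mul0r addr0 gap_tau mul1r -/(tau' t) gap_tau'.
by rewrite !mulr0 addr0.
Qed.

Lemma K_convex x y (t : R) : 0 <= t <= 1 -> K x -> K y ->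
  K ((1 - t)%:C * x + t%:C * y).
Proof. by have [G [G0 ->]] := K_coords 0; exact: node_range_convex. Qed.

(** * The set cut out by all the half-planes *)

Lemma mid_continuous : continuous mid.
Proof. by move=> t; exact: is_derive_cont (is_derive_mid t). Qed.

Lemma midD2pin t k : mid (t + k%:R * (2 * pi)) = mid t + k%:R * (2 * pi).
Proof.
elim: k => [|k IHk]; first by rewrite mul0r !addr0.
by rewrite -natr1 mulrDl mul1r addrA midD2pi IHk addrA.
Qed.

Lemma mid_surj y : exists t, mid t = y.
Proof.
have [k hk] : exists k : nat, `|y - mid 0| <= k%:R * (2 * pi).
  exists (Num.bound `|y - mid 0|); have := ltW (archi_boundP (normr_ge0 (y - mid 0))).
  have hp := pi_ge2 R => hz; apply: le_trans hz _; rewrite ler_peMr//; lra.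
have kp : 0 <= k%:R * (2 * pi) :> R by exact: le_trans (normr_ge0 _) hk.
have h1 := midD2pin 0 k; rewrite add0r in h1.
have h2 := midD2pin (- (k%:R * (2 * pi))) k; rewrite addNr in h2.
move: hk; rewrite ler_norml => /andP[ha hb].
have cw : {within `[- (k%:R * (2 * pi)), k%:R * (2 * pi)], continuous mid}.
  by apply: continuous_subspaceT => t; exact: mid_continuous.
have [||t _ <-] := @IVT _ _ (- (k%:R * (2 * pi))) (k%:R * (2 * pi)) y _ cw.
- lra.
- by rewrite ge_min le_max; apply/andP; split; apply/orP; [left|right]; lra.
- by exists t.
Qed.

Lemma gap_translate t x (a b : R) :
  gap t (x + (a +i* b)) = gap t x - (a * cos (mid t) + b * sin (mid t)).
Proof. by rewrite /gap; case: x => c d /=; ring. Qed.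

(** By periodicity the gap has a positive minimum over all t; half of it may be spent along each
    axis, since normals have entries of modulus at most 1. *)
Lemma gap_pos_ball x : (forall t, 0 < gap t x) -> exists2 e, 0 < e &
  forall a b : R, `|a| <= e -> `|b| <= e -> forall t, 0 <= gap t (x + (a +i* b)).
Proof.
move=> xI; have cg : {within `[0, 2 * pi], continuous (gap^~ x)}.
  by apply: continuous_subspaceT => t; exact: is_derive_cont (is_derive_gap t x).
have pi0 := pi_gt0 R.
have [|t0 _ tmin] := EVT_min _ cg; first lra.
have per k s : gap (s + k%:R * (2 * pi)) x = gap s x.
  elim: k => [|k IHk]; first by rewrite mul0r addr0.
  by rewrite -natr1 mulrDl mul1r addrA gapD2pi.
have gmin t : gap t0 x <= gap t x.
  have p2 : 0 < 2 * pi :> R by lra.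
  have [k [h1 h2]] : exists k : int, k%:~R * (2 * pi) <= t /\ t < (k + 1)%:~R * (2 * pi).
    exists (Num.floor (t / (2 * pi))).
    by rewrite -ler_pdivlMr// -ltr_pdivrMr// floor_le floorD1_gt.
  have -> : gap t x = gap (t - k%:~R * (2 * pi)) x.
    case: k {h1 h2} => k; first by rewrite -[in LHS](subrK (k%:R * (2 * pi)) t) per.
    by rewrite NegzE mulrNz mulNr opprK per.
  apply: tmin; rewrite in_itv/=; apply/andP; split; first by lra.
  by move: h2; rewrite intrD mulrDl mul1r; lra.
exists (gap t0 x / 2); first by rewrite divr_gt0.
move=> a b ha hb t; rewrite gap_translate subr_ge0.
apply: le_trans (gmin t).
have hc := cos_max (mid t); have hs := sin_max (mid t).
have h1 : a * cos (mid t) <= gap t0 x / 2.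
  rewrite (le_trans (ler_norm _))// normrM -[leRHS]mulr1.
  by rewrite ler_pM.
have h2 : b * sin (mid t) <= gap t0 x / 2.
  rewrite (le_trans (ler_norm _))// normrM -[leRHS]mulr1.
  by rewrite ler_pM.
by lra.
Qed.

(* The last point of the horizontal ray from x that satisfies all the
   inequalities 0 <= gap t lies on one of the lines gap t = 0. *)
Lemma gap_ray x (e : R) : e = 1 \/ e = -1 -> (forall t, 0 <= gap t x) ->
  exists2 s : R, 0 <= s & K (x + (e * s +i* 0)).
Proof.
move=> e1 xI.
have gE t s : gap t (x + (e * s +i* 0)) = gap t x - s * (e * cos (mid t)).
  by rewrite gap_translate; ring.
pose S := [set s : R | 0 <= s /\ forall t, 0 <= gap t (x + (e * s +i* 0))].
have S0 : S 0 by split=> // t; rewrite gE mul0r subr0.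
(* The line whose outer normal points along the ray bounds [s]. *)
have Sub s : S s -> s <= 1 - e * complex.Re x.
  move=> [s0 sI]; have [t0 [c0 n0]] : exists t0, cos (mid t0) = e /\ sin (mid t0) = 0.
    case: e1 => ->; [have [t0 ht] := mid_surj 0|have [t0 ht] := mid_surj pi].
      by exists t0; rewrite ht cos0 sin0.
    by exists t0; rewrite ht cospi sinpi.
  have := sI t0; rewrite gE /gap c0 n0 mulr0 addr0; have := cos_le1 (half t0).
  have ee : e * e = 1 by case: e1 => ->; rewrite ?mulrNN mulr1.
  by rewrite ee; lra.
have hS : has_sup S.
  by split; [exists 0|exists (1 - e * complex.Re x) => s /Sub].
pose m := sup S.
have m0 : 0 <= m by apply: sup_upper_bound.
have mI t : 0 <= gap t (x + (e * m +i* 0)).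
  rewrite gE subr_ge0; have [c0|c0] := leP (e * cos (mid t)) 0.
    by apply: le_trans (xI t); rewrite mulr_ge0_le0.
  rewrite -ler_pdivlMr//; apply: ge_sup; first by exists 0.
  by move=> s [_ /(_ t)]; rewrite gE subr_ge0 -ler_pdivlMr.
exists m => //.
have [[t /eqP tm]|nt] := pselect (exists t, gap t (x + (e * m +i* 0)) == 0).
  by rewrite (gap_contact mI tm); exact: K_curve.
exfalso; have pos t : 0 < gap t (x + (e * m +i* 0)).
  rewrite lt_neqAle mI andbT eq_sym; apply/negP => h; apply: nt; by exists t.
have [d d0 dI] := gap_pos_ball pos.
have : S (m + d).
  split=> [|t]; first by rewrite addr_ge0// ltW.
  have := dI (e * d) 0; rewrite normr0 (ltW d0) normrM (gtr0_norm d0).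
  have -> : `|e| = 1 by case: e1 => ->; rewrite ?normrN normr1.
  rewrite mul1r lexx => /(_ isT isT t); rewrite -addrA.
  by have -> : (e * m +i* 0) + (e * d +i* 0) = (e * (m + d) +i* 0) :> C
    by apply/eqP; rewrite eq_complex/= mulrDr addr0 !eqxx.
move=> /(sup_upper_bound hS); rewrite -/m; lra.
Qed.

(** Opposite horizontal rays from x reach points of [K], and x lies between them; convexity of [K]
    concludes. *)
Lemma gap_K x : (forall t, 0 <= gap t x) -> K x.
Proof.
move=> xI; have [p p0 Kp] := gap_ray (or_introl erefl) xI.
have [q q0 Kq] := gap_ray (or_intror erefl) xI.
have [pq0|pq0] := eqVneq (p + q) 0.
  have p00 : p = 0 by lra.
  by move: Kp; rewrite p00 mulr0 addr0.
have pq : 0 < p + q by rewrite lt_neqAle eq_sym pq0 addr_ge0.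
have := @K_convex _ _ (p / (p + q)) _ Kp Kq.
have -> : (1 - p / (p + q))%:C * (x + (1 * p +i* 0)) +
   (p / (p + q))%:C * (x + (-1 * q +i* 0)) = x.
  case: (x) => a b; apply/eqP; rewrite eq_complex/=.
  by apply/andP; split; apply/eqP; field.
apply; apply/andP; split; first by rewrite divr_ge0// ltW.
by rewrite ler_pdivrMr// mul1r lerDl.
Qed.

Lemma K_interior x : (forall t, 0 < gap t x) -> interior (K : set C^o) x.
Proof.
move=> /gap_pos_ball[e e0 eI]; apply/interior_nsq; exists e => // y ye.
have small (a : R) : a ^+ 2 < e ^+ 2 -> `|a| <= e.
  move=> h; rewrite -ler_sqr ?nnegrE ?normr_ge0 ?ltW//.
  by rewrite real_normK ?num_real// ltW.
have := eI (complex.Re (y - x)) (complex.Im (y - x)).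
rewrite (small _ (le_lt_trans (Re_nsq _) ye)) (small _ (le_lt_trans (Im_nsq _) ye)).
move=> /(_ isT isT) h; apply: gap_K => t.
have -> : y = x + (complex.Re (y - x) +i* complex.Im (y - x)); last exact: h.
by rewrite -[LHS](subrK x) addrC; congr (_ + _); case: (y - x).
Qed.

Lemma K_boundary : boundary K = range curve.
Proof.
have clK x : closure (K : set C^o) x -> K x.
  move=> cx; apply: gap_K => t; rewrite leNgt; apply/negP => g0.
  have e0 : 0 < - gap t x / 2 by rewrite divr_gt0// oppr_gt0.
  have [y Ky ye] := closure_nsq cx e0.
  have := K_gap t Ky; have hR := le_lt_trans (Re_nsq _) ye.
  have hI := le_lt_trans (Im_nsq _) ye.
  have small (a : R) : a ^+ 2 < (- gap t x / 2) ^+ 2 -> `|a| < - gap t x / 2.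
    move=> h; rewrite -ltr_sqr ?nnegrE ?normr_ge0 ?(ltW e0)//.
    by rewrite real_normK ?num_real.
  have -> : y = x + (complex.Re (y - x) +i* complex.Im (y - x)).
    by rewrite -[LHS](subrK x) addrC; congr (_ + _); case: (y - x).
  rewrite gap_translate; set a := complex.Re _; set b := complex.Im _.
  have bnd (r c : R) : `|r| < - gap t x / 2 -> `|c| <= 1 -> - (r * c) < - gap t x / 2.
    move=> h1 h2; apply: le_lt_trans h1; apply: le_trans (ler_norm _) _.
    by rewrite normrN normrM ler_piMr.
  have h1 := bnd _ _ (small _ hR) (cos_max (mid t)).
  have h2 := bnd _ _ (small _ hI) (sin_max (mid t)).
  by move: h1 h2; rewrite -/a -/b; lra.
apply/seteqP; split=> [x [/clK Kx nx]|_ [t _ <-]].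
  apply: contrapT => nr; apply: nx; apply: K_interior => t.
  rewrite lt_neqAle K_gap// andbT eq_sym; apply/eqP => g0; apply: nr.
  by exists t => //; apply/esym/gap_contact => // s; exact: K_gap.
split; first by apply: subset_closure; exact: K_curve.
(* Moving by e / 2 along the outer normal would make the gap equal to - e / 2. *)
move=> /interior_nsq[e e0 eK].
have := K_gap t (eK (curve t + ((e / 2) * cos (mid t) +i* ((e / 2) * sin (mid t)))) _).
rewrite gap_translate gap_curve.
have -> : e / 2 * cos (mid t) * cos (mid t) + e / 2 * sin (mid t) * sin (mid t) = e / 2.
  by rewrite -[RHS]mulr1 -(cos2Dsin2 (mid t)); ring.
have h : nsq (curve t + (e / 2 * cos (mid t) +i* (e / 2 * sin (mid t)))
              - curve t) < e ^+ 2.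
  rewrite addrC addKr /nsq /=.
  have -> : (e / 2 * cos (mid t)) ^+ 2 + (e / 2 * sin (mid t)) ^+ 2 = (e / 2) ^+ 2.
    by rewrite -[RHS]mulr1 -(cos2Dsin2 (mid t)); ring.
  by rewrite ltr_pXn2r ?nnegrE//; lra.
by move=> /(_ h); lra.
Qed.

(** The supporting line at [curve t] has normal [cis (mid t)]. The midpoint of a segment in the
    boundary is some [curve t]; both ends then lie on the line of parameter t, which has a single
    contact point. *)
Lemma K_strictly_convex : strictly_convex_curve (boundary K).
Proof.
rewrite K_boundary; split=> [_ [t _ <-]|a b ab].
  exists (cis (mid t)); split.
    move=> h; have := norm_cis (mid t); rewrite h normr0 => /eqP.
    by rewrite eq_sym oner_eq0.
  move=> _ [s _ <-]; have := K_gap t (K_curve s); have := gap_curve t.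
  by rewrite /gap /cis; case: (curve s) (curve t) => p q [p' q'] /=; lra.
have [t _ mt] : range curve ((1 - 2^-1)%:C * a + (2^-1)%:C * b).
  apply: ab; exists 2^-1 => //; rewrite /= in_itv/= ; apply/andP; split; lra.
have Ka : K a by have [s _ <-] := ab _ (segment_left a b); exact: K_curve.
have Kb : K b by have [s _ <-] := ab _ (segment_right a b); exact: K_curve.
have := gap_curve t; rewrite mt gap_convex; last by lra.
have ga := K_gap t Ka; have gb := K_gap t Kb => h.
rewrite (@gap_contact t a); [|by move=> s; exact: K_gap|by lra].
by rewrite (@gap_contact t b)//; [move=> s; exact: K_gap|lra].
Qed.

(** * Injectivity and regularity of the boundary curve *)

Lemma quadratic_disc (a b c : R) :
  (forall e, 0 <= a + 2 * b * e + c * e ^+ 2) -> b ^+ 2 <= a * c.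
Proof.
move=> q; have a0 : 0 <= a by have := q 0; rewrite expr0n/= !mulr0 !addr0.
case: (ltrgtP c 0) => c0.
(* With r = a / c, the values at 1 - r and r - 1 average to c (1 - r + r^2), which is negative. *)
- exfalso; pose r := a / c; have ac : a = r * c by rewrite /r divfK// lt_eqF.
  have h : 0 <= c * (1 - r + r ^+ 2).
    have := q (1 - r); have := q (- (1 - r)); rewrite ac sqrrN => h1 h2.
    have -> : c * (1 - r + r ^+ 2) = r * c + c * (1 - r) ^+ 2 by ring.
    by move: h1 h2; rewrite mulrN; lra.
  by move: h; rewrite nmulr_rge0// => h; have := sqr_ge0 (1 - 2 * r); lra.
- have := q (- b / c).
  have -> : a + 2 * b * (- b / c) + c * (- b / c) ^+ 2 = (a * c - b ^+ 2) / c.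
    by field; rewrite gt_eqF.
  by rewrite pmulr_lge0 ?invr_gt0// subr_ge0.
- have [->|b0] := eqVneq b 0; first by rewrite expr0n c0 mulr0.
  have := q (- (a + 1) / (2 * b)); rewrite c0 mul0r addr0.
  have -> : a + 2 * b * (- (a + 1) / (2 * b)) = -1 by field.
  by move=> ?; exfalso; lra.
Qed.

Lemma gap_moment (G : 'I_n.+1 -> R) (d : 'I_n.+1 -> C) s t :
  (forall i, 0 < G i) -> K = node_range (@popuc_zero R n tau t) G ->
  \sum_i d i = 0 ->
  0 <= \sum_i G i * nsq (d i) * gap s (@popuc_zero R n tau t i).
Proof.
move=> G0 KE d0; have := mass_ge0 G0 d; rewrite le_eqVlt => /predU1P[m0|m0].
  rewrite big1// => i _; rewrite (mass_eq0 G0 i (esym m0)).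
  by rewrite /nsq /= expr0n addr0 mulr0 mul0r.
have := node_range_cone (@popuc_zero R n tau t) d0 m0; rewrite -KE => /(K_gap s).
move: (@popuc_zero R n tau t) => z.
have -> : gap s ((mass G d)^-1%:C * moment z G d) =
   (mass G d)^-1 * \sum_i G i * nsq (d i) * gap s (z i).
  have e : (mass G d)^-1 * mass G d = 1 by rewrite mulVf// gt_eqF.
  rewrite {1}/gap ReZ ImZ /moment Re_sum Im_sum -[in LHS](mul1r (cos (half s))) -e.
  rewrite -!mulrA -mulrDr -mulrBr; congr (_ * _).
  rewrite /mass !mulr_suml -big_split -sumrB; apply: eq_bigr => i _.
  by rewrite /gap; case: (z i) => p q /=; ring.
by rewrite pmulr_rge0// invr_gt0.
Qed.

(* gap s is nonnegative at the points of K with coordinates (1, -1 - e, e) at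
   three of the zeros; as a function of e this is a quadratic polynomial, and the
   inequality below is the sign of its discriminant. *)
Lemma chord_weights t : (1 < n)%N -> exists G1 G2 G3 z3, [/\ 0 < G1, 0 < G2 &
  forall s, let A := G1 * gap s (cis (tau t)) in
            let B := G2 * gap s (cis (tau' t)) in
    A + B = (G1 + G2) * gap s (curve t) /\
    B ^+ 2 <= (A + B) * (B + G3 * gap s z3)].
Proof.
move=> n1; have [G [G0 KE]] := K_coords t.
pose z := @popuc_zero R n tau t.
pose i0 : 'I_n.+1 := ord0; pose i1 : 'I_n.+1 := Ordinal (n_gt0 : (1 < n.+1)%N).
pose i2 : 'I_n.+1 := Ordinal (n1 : (2 < n.+1)%N).
exists (G i0), (G i1), (G i2), (z i2); split=> // s A B.
have z0E : z i0 = cis (tau t) by rewrite /z popuc_zeroE mul0r addr0.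
have z1E : z i1 = cis (tau' t) by rewrite /z popuc_zeroE mul1r.
split.
  have Kx := @node_range_pair _ _ z G i0 i1 G0 isT.
  rewrite -KE in Kx; rewrite -(@gap_contact t _ (fun s => K_gap s Kx)).
    rewrite gap_convex; last by rewrite -mulrDl divff// gt_eqF// addr_gt0.
    rewrite z0E z1E /A /B; have h : G i0 + G i1 != 0 by rewrite gt_eqF// addr_gt0.
    by field.
  rewrite gap_convex; last by rewrite -mulrDl divff// gt_eqF// addr_gt0.
  by rewrite z0E z1E gap_tau gap_tau' !mulr0 addr0.
apply: quadratic_disc => e.
pose d (i : 'I_n.+1) : C := ((i == i0)%:R - (1 + e) * (i == i1)%:R + e * (i == i2)%:R)%:C.
have big3 (V : nmodType) (F : 'I_n.+1 -> V) :
    (forall i, i != i0 -> i != i1 -> i != i2 -> F i = 0) ->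
    \sum_i F i = F i0 + (F i1 + F i2).
  move=> F0; rewrite (bigD1 i0)//= (bigD1 i1)//= (bigD1 i2)//= big1 ?addr0//.
  by move=> i /andP[/andP[h1 h2] h3]; exact: F0.
have d0 : \sum_i d i = 0.
  rewrite big3 => [|i /negbTE h0 /negbTE h1 /negbTE h2]; last first.
    by rewrite /d h0 h1 h2 !mulr0 subr0 addr0.
  by rewrite /d /= -!rmorphD; congr (_%:C); ring.
have := gap_moment s G0 KE d0.
rewrite big3 => [|i /negbTE h0 /negbTE h1 /negbTE h2]; last first.
  by rewrite /d h0 h1 h2 !mulr0 subr0 addr0 /nsq/= expr0n addr0 mulr0 mul0r.
rewrite -/z z0E z1E /d /nsq /=.
rewrite [X in 0 <= X -> _](_ : _ =
  A + B + 2 * B * e + (B + G i2 * gap s (z i2)) * e ^+ 2)//.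
by rewrite /A /B; ring.
Qed.

Lemma gap_cis_eq0 s a : gap s (cis a) = 0 ->
  cis a = cis (tau s) \/ cis a = cis (tau' s).
Proof.
have [b ->] : exists b, a = mid s + b by exists (a - mid s); lra.
rewrite gap_cis addrAC subrr add0r => /eqP; rewrite subr_eq0 => /eqP hc.
have : sin b ^+ 2 = sin (half s) ^+ 2 by rewrite !sin2cos2 hc.
move=> /eqP; rewrite eqf_sqr => /orP[/eqP hs|/eqP hs]; [right|left].
  by rewrite -midDhalf !cisD /cis -hc hs.
by rewrite -midBhalf !cisD cisN /cis -hc hs.
Qed.

(** The lines of parameters t and t + 2 pi coincide, and a line has a single contact point. *)
Lemma curve_D2pi t : curve (t + 2 * pi) = curve t.
Proof.
apply: gap_contact => [s|]; first exact/K_gap/K_curve.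
by rewrite -gapD2pi gap_curve.
Qed.

(** If the curve returned, [gap s] would vanish at [curve t], and [chord_weights] would make it
    vanish at both ends of the chord of t. Then t = s + step, and t + step would be s or s + step,
    which three zeros per turn exclude. *)
Lemma curve_inj_lt s t : (1 < n)%N -> s < t -> t < s + 2 * pi -> curve s <> curve t.
Proof.
move=> n1 st ts cst; have [G1 [G2 [G3 [z3 [G10 G20 h]]]]] := chord_weights t n1.
have /= [e1 e2] := h s; rewrite -cst gap_curve mulr0 in e1.
rewrite e1 mul0r in e2.
have B0 : gap s (cis (tau' t)) = 0.
  have : (G2 * gap s (cis (tau' t))) ^+ 2 == 0 by rewrite eq_le e2 sqr_ge0.
  by rewrite sqrf_eq0 mulf_eq0 gt_eqF//= => /eqP.
have A0 : gap s (cis (tau t)) = 0.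
  by move: e1 => /eqP; rewrite B0 mulr0 addr0 mulf_eq0 gt_eqF//= => /eqP.
have near a b : s <= a -> a < s + 2 * pi -> s <= b -> b < s + 2 * pi ->
    cis (tau a) = cis (tau b) -> a = b.
  move=> a1 a2 b1 b2 /cis_inj ab.
  have /ab tab : `|tau a - tau b| < 2 * pi.
    have := tau_le a1; have := tau_le b1; have := tau_lt a2; have := tau_lt b2.
    by rewrite tauD2pi => *; rewrite ltr_norml; apply/andP; split; lra.
  by case: (ltgtP a b) => // /tau_lt; rewrite tab ltxx.
have w0 := step_gt0; have N3 : 3 <= n.+1%:R :> R by rewrite ler_nat.
have wN := stepE; have w3 : 3 * step <= 2 * pi by rewrite -wN ler_wpM2r// ltW.
have w2 : step < 2 * pi by lra.
have tE : t = s + step.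
  case: (gap_cis_eq0 A0) => /near; last by apply; lra.
  by move=> ht; exfalso; have := ht (ltW st) ts (lexx _); lra.
have : t + step = s \/ t + step = s + step.
  by case: (gap_cis_eq0 B0) => /near ht; [left|right]; apply: ht; lra.
by case; lra.
Qed.

Lemma continuous_real_near (g : R -> R) t (e : R) : {for t, continuous g} -> 0 < e ->
  exists2 r : R, 0 < r & forall s, `|s - t| < r -> `|g s - g t| < e.
Proof.
move=> /cvgrPdist_lt/(_ e) h e0; have /nbhs_ballP[r /= r0 hr] := h e0.
exists r => // s sr; rewrite distrC; apply: hr.
by rewrite -ball_normE /= distrC.
Qed.

(* If the velocity vanished at t, then gap s (curve t) would be o((s - t)^2),
   whereas chord_weights bounds it below by a multiple of the square of
   s |-> gap s (cis (tau' t)), whose derivative at t is not 0. *)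
Lemma curve_regular t (dx dy : R) : (1 < n)%N -> ode_function v ->
  is_derive t 1 curve_re dx -> is_derive t 1 curve_im dy -> dx != 0 \/ dy != 0.
Proof.
move=> n1 ov; case: (eqVneq dx 0) => [->|dx0 _ _]; last by left.
case: (eqVneq dy 0) => [-> hx hy|dy0 _ _]; last by right.
exfalso; have [dv [_ dvE]] := ode_function_derive ov.
pose D s := dgap s (curve t).
have Dt : D t = 0 by exact: dgap_curve.
have dD : is_derive t 1 D 0.
  (* Subtracting [dgap s (curve s)], which is 0, leaves [dmid s] times a linear form in
     [curve t - curve s]; its derivative at t vanishes with the velocity. *)
  pose w s := (curve_re t - curve_re s) * sin (mid s)
            - (curve_im t - curve_im s) * cos (mid s).
  have DE : D = fun s => dmid s * w s.
    apply/funext => s; rewrite /D -[LHS]subr0 -(dgap_curve s) /dgap /w /=; ring.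
  have dc := is_derive_compf (is_derive_mid t) (is_derive_cos (mid t)).
  have dsn := is_derive_compf (is_derive_mid t) (is_derive_sin (mid t)).
  have dw : is_derive t 1 w 0.
    have hh := is_derive_subf
      (is_derive_mulf (is_derive_subf (is_derive_constf (curve_re t) t) hx) dsn)
      (is_derive_mulf (is_derive_subf (is_derive_constf (curve_im t) t) hy) dc).
    by apply: (is_derive_eq hh); rewrite !subrr !mul0r !addr0 subrr.
  have dm := is_derive_mulf (is_derive_addf (is_derive_compf (dtau t) (dvE (tau t)))
      (is_derive_compf (is_derive_tau' t) (dvE (tau' t)))) (is_derive_constf 2^-1 t).
  rewrite DE; apply: (is_derive_eq (is_derive_mulf dm dw)).
  by rewrite /w !subrr !mul0r subrr !mulr0 addr0.
have [G1 [G2 [G3 [z3 [G10 G20 hG]]]]] := chord_weights t n1.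
(* The derivative of [B] at t. It equals - G2 v (tau' t) sin (half t), nonzero because half t lies
   strictly between 0 and pi. *)
pose b1 := G2 * dgap t (cis (tau' t)).
have b1n : b1 != 0.
  apply: mulf_neq0; first by rewrite gt_eqF.
  rewrite /dgap /cis /= [cos (tau' t) * _]mulrC [sin (tau' t) * _]mulrC -sinB.
  have -> : mid t - tau' t = - half t by rewrite -midDhalf; lra.
  have -> : - dhalf t * sin (half t) + dmid t * sin (- half t) =
     - (v (tau' t) * sin (half t)) by rewrite sinN /dhalf /dmid; field.
  by rewrite oppr_eq0 mulf_neq0 ?gt_eqF// sin_gt0_pi// half_bounds.
pose B s := G2 * gap s (cis (tau' t)).
have Bt : B t = 0 by rewrite /B gap_tau' mulr0.
have dB : is_derive t 1 B b1.
  have hh := is_derive_mulf (is_derive_constf G2 t) (is_derive_gap t (cis (tau' t))).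
  by apply: (is_derive_eq hh); rewrite mul0r add0r.
pose Cc s := B s + G3 * gap s z3.
have cC : {for t, continuous Cc}.
  have hh := is_derive_addf dB
    (is_derive_mulf (is_derive_constf G3 t) (is_derive_gap t z3)).
  exact: is_derive_cont hh.
(* Continuous difference quotients replace second derivatives: gap s (curve t) is s - t times a
   value of [D], and [D] is o(s - t). *)
have /is_derive1_caratheodory[gD [gDE cgD gDt]] := dD.
have /is_derive1_caratheodory[gB [gBE cgB gBt]] := dB.
pose M := (G1 + G2) * (`|Cc t| + 1).
have M0 : 0 < M by apply: mulr_gt0; [exact: addr_gt0|rewrite ltr_wpDl].
have b10 : 0 < `|b1| by rewrite normr_gt0.
(* Chosen so that [chord_weights] at s yields (gB s)^2 <= b1^2 / 8, against the lower bound b1^2 /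
   4. *)
pose eta := b1 ^+ 2 / 8 / M.
have eta0 : 0 < eta by rewrite !divr_gt0// exprn_even_gt0.
have [r1 r10 hr1] := continuous_real_near cgD eta0.
have [|r2 r20 hr2] := continuous_real_near cgB (_ : 0 < `|b1| / 2).
  by rewrite divr_gt0.
have [r3 r30 hr3] := continuous_real_near cC ltr01.
have [h h0 [hh1 hh2 hh3]] : exists2 h, 0 < h & [/\ h < r1, h < r2 & h < r3].
  exists (Num.min r1 (Num.min r2 r3) / 2).
    by rewrite divr_gt0// !lt_min r10 r20 r30.
  have m1 : Num.min r1 (Num.min r2 r3) <= r1 by rewrite ge_min lexx.
  have m2 : Num.min r1 (Num.min r2 r3) <= r2 by rewrite !ge_min lexx orbT.
  have m3 : Num.min r1 (Num.min r2 r3) <= r3 by rewrite !ge_min lexx !orbT.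
  by split; lra.
pose s := t + h; have sh : s - t = h by rewrite /s; lra.
have nh : `|s - t| = h by rewrite sh gtr0_norm.
have [c [ct _ EE]] := mean_value t s (fun u => is_derive_gap u (curve t)).
rewrite gap_curve subr0 -/(D c) in EE.
have Dc : D c = gD c * (c - t) by rewrite -gDE Dt subr0.
have Bs : B s = gB s * h by rewrite -sh -gBE Bt subr0.
have /= [e1 e2] := hG s; rewrite e1 -/(B s) -/(Cc s) EE Dc sh Bs in e2.
rewrite nh in ct.
have k1 : `|gD c| < eta by have := hr1 c (le_lt_trans ct hh1); rewrite gDt subr0.
have k2 : `|gB s - b1| < `|b1| / 2 by have := hr2 s; rewrite nh gBt; apply.
have k3 : `|Cc s| <= `|Cc t| + 1.
  have := hr3 s; rewrite nh => /(_ hh3) k; have := ler_distD 0 (Cc s) (Cc t).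
  rewrite !subr0 sub0r normrN => _.
  rewrite -[Cc s](subrK (Cc t)); apply: le_trans (ler_normD _ _) _.
  by rewrite addrC lerD2l ltW.
have k4 : `|b1| / 2 <= `|gB s|.
  have := ler_normD (gB s) (b1 - gB s); rewrite addrC subrK distrC; move: k2; lra.
have k5 : (gB s * h) ^+ 2 <= M * eta * h ^+ 2.
  apply: le_trans e2 _; apply: le_trans (ler_norm _) _; rewrite !normrM.
  rewrite (gtr0_norm h0) (gtr0_norm (addr_gt0 G10 G20)).
  have -> : (G1 + G2) * (`|gD c| * `|c - t| * h) * `|Cc s| =
     ((G1 + G2) * `|Cc s|) * `|gD c| * (`|c - t| * h) by ring.
  apply: ler_pM; rewrite ?mulr_ge0 ?(ltW h0) ?(ltW (addr_gt0 G10 G20))//.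
    apply: ler_pM; rewrite ?mulr_ge0 ?(ltW (addr_gt0 G10 G20)) ?(ltW k1)//.
    by rewrite ler_wpM2l// ltW// addr_gt0.
  by rewrite expr2 ler_wpM2r// ltW.
have h2 : 0 < h ^+ 2 by rewrite exprn_gt0.
move: k5; rewrite exprMn ler_pM2r//.
have -> : M * eta = b1 ^+ 2 / 8 by rewrite /eta mulrC divfK// gt_eqF.
have k6 : (`|b1| / 2) ^+ 2 <= gB s ^+ 2.
  by rewrite -(real_normK (num_real (gB s))) ler_sqr ?nnegrE// divr_ge0.
have k7 : (`|b1| / 2) ^+ 2 = b1 ^+ 2 / 4.
  by rewrite exprMn real_normK ?num_real//; field.
have k8 : 0 < b1 ^+ 2 by rewrite exprn_even_gt0.
by move: k6; rewrite k7; lra.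
Qed.

Lemma ode_function_curve : ode_function v ->
  ode_function curve_re /\ ode_function curve_im.
Proof.
move=> ov; have [oc os] := ode_function_cos_sin R.
have hv := ode_function_flow ov dtau ov.
have hc := ode_function_flow ov dtau oc.
have hs := ode_function_flow ov dtau os.
have hv' := ode_function_shift step hv.
have hc' := ode_function_shift step hc.
have hs' := ode_function_shift step hs.
have hi := ode_function_inv v_sum_neq0 (ode_function_add hv hv').
split; apply: ode_function_mul => //.
- by apply: ode_function_add; apply: ode_function_mul.
- by apply: ode_function_add; apply: ode_function_mul.
Qed.

Lemma K_analytic_boundary : (1 < n)%N -> ode_function v ->
  analytic_closed_curve (boundary K).
Proof.
move=> n1 ov; have [ox oy] := ode_function_curve ov.
exists curve_re, curve_im; split.
- by split; exact: ode_function_analytic.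
- by split=> t; have [] := curve_D2pi t.
- move=> s t; rewrite !in_itv/= => /andP[s0 s1] /andP[t0 t1] xe ye.
  have cst : curve s = curve t by rewrite /curve xe ye.
  case: (ltgtP s t) => // [st|ts]; exfalso.
    by apply: (curve_inj_lt n1 st) cst; lra.
  by apply: (curve_inj_lt n1 ts) (esym cst); lra.
- move=> t; have [gx [_ dx]] := ode_function_derive ox.
  have [gy [_ dy]] := ode_function_derive oy.
  rewrite !derive1E (@derive_val _ _ _ _ _ _ _ (dx t)) (@derive_val _ _ _ _ _ _ _ (dy t)).
  exact: curve_regular n1 ov (dx t) (dy t).
- exact: K_boundary.
Qed.

End Envelope.

(** For two nodes d_0 = - d_1, and the normalisation fixes |d_1|^2 = 1 / (G_0 + G_1): no freedom
    remains. *)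
Lemma node_range_subsingleton (R : realType) (z : 'I_2 -> R[i]) (G : 'I_2 -> R) x y :
  (forall i, 0 < G i) -> node_range z G x -> node_range z G y -> x = y.
Proof.
move=> G0; have s0 : 0 < G ord0 + G ord_max by rewrite addr_gt0.
have sum2 (V : nmodType) (f : 'I_2 -> V) : \sum_i f i = f ord0 + f ord_max.
  by rewrite big_ord_recr big_ord1/=; congr (f _ + _); apply: val_inj.
suff sol w : node_range z G w ->
    w = (G ord0 / (G ord0 + G ord_max))%:C * z ord0 +
        (G ord_max / (G ord0 + G ord_max))%:C * z ord_max.
  by move=> /sol -> /sol ->.
move=> [d []]; rewrite !sum2 => /eqP; rewrite addr_eq0 => /eqP -> d1 <-.
have nN : nsq (- d ord_max) = nsq (d ord_max).
  by case: (d ord_max) => a b; rewrite /nsq/= !sqrrN.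
rewrite nN in d1 *; have -> : nsq (d ord_max) = (G ord0 + G ord_max)^-1.
  by apply: (mulfI (lt0r_neq0 s0)); rewrite mulrDl d1 divff// gt_eqF.
by [].
Qed.

Theorem theorem5 (R : realType) (n : nat) (n_gt0 : (0 < n)%N)
    (alpha : nat -> R[i])
    (alpha_disk : forall j : nat, (j < n)%N -> `|alpha j| < 1)
    (lambda0 : R[i]) (lambda0_circle : `|lambda0| = 1) :
  [/\ forall lambda : R[i], `|lambda| = 1 ->
        solid_polygon n.+1 (NU alpha n lambda) /\
        (forall a b : R[i], side (NU alpha n lambda) a b ->
           tangent_segment a b (NA alpha n lambda0)),
      strictly_convex_curve (boundary (NA alpha n lambda0)),
      (n = 1%N -> exists p : R[i], boundary (NA alpha n lambda0) = [set p]),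
      ((1 < n)%N -> analytic_closed_curve (boundary (NA alpha n lambda0))) &
      NA alpha n lambda0 =
        \bigcap_(lambda in [set l : R[i] | `|l| = 1]) NU alpha n lambda].
Proof.
have [v [tau [[ov v0 dtau tau2] [NUE NUt NAE]]]] :=
  popuc_geometry alpha_disk lambda0_circle.
set K := NA alpha n lambda0 in NAE *.
have bE := K_boundary n_gt0 v0 dtau tau2 NAE.
split.
- move=> lambda /NUE[t [-> zi]]; split.
    by apply: unit_circle_polygon => // i; exact: norm_cis.
  by move=> a b; have [G [G0 ->]] := NAE t; exact: side_tangent.
- exact: K_strictly_convex n_gt0 v0 dtau tau2 NAE.
(* In dimension 1 the numerical range is a single point, so the curve is constant. *)
- move=> n1; exists (curve n v tau 0); rewrite bE.
  apply/seteqP; split=> [_ [t _ <-]|_ ->]; last by exists 0.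
  have Kc := K_curve n_gt0 v0 dtau tau2 NAE.
  have [G [G0 KE]] := NAE 0; rewrite KE in Kc.
  move: G G0 Kc {KE NAE NUE NUt bE n_gt0 alpha_disk}; rewrite n1 => G G0 Kc.
  exact: node_range_subsingleton G0 (Kc t) (Kc 0).
- by move=> n1; exact: (K_analytic_boundary n_gt0 v0 dtau tau2 NAE).
- apply/seteqP; split=> [x Kx lambda /NUE[t [-> _]]|x xU].
    exact: K_hull NAE t x Kx.
  (* Of each polygon only the side joining the first two zeros is kept; as t varies these lines cut
     out N(A). *)
  apply: (gap_K n_gt0 v0 dtau tau2 NAE) => t.
  have [lambda l1 e] := NUt t.
  by apply: (gap_hull n_gt0 v0 dtau tau2); rewrite -e; exact: xU.
Qed.
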